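(* Let $L\ge 1$, let $\alpha>0$ and $\alpha_0\in[\alpha,2\alpha)$. Let $\mathbf W_1=(W_{11},\dots,W_{1L})$ be a random vector in $\mathbb R_+^L$ with continuous distribution, let $c_1,\dots,c_L>0$ be constants, and set $\boldsymbol{\mathcal W}_1=(c_1W_{11},\dots,c_LW_{1L})$. Let $\boldsymbol{\mathcal D}_1=(\mathcal D_{11},\dots,\mathcal D_{1L})$ be a random vector which, conditionally on $\mathbf W_1$, has independent entries with $\mathcal D_{1l}\sim\mathrm{Poisson}(c_lW_{1l})$, $l=1,\dots,L$. (a) If $\mathbb P(\boldsymbol{\mathcal W}_1\in\cdot)\in\mathrm{MRV}(\alpha,b(t),\nu,\mathbb R_+^L\setminus\{\mathbf 0\})$ for some scaling function $b(t)\in RV_{1/\alpha}$ and limit measure $\nu$, then $\mathbb P(\boldsymbol{\mathcal D}_1\in\cdot)\in\mathrm{MRV}(\alpha,b(t),\nu,\mathbb R_+^L\setminus\{\mathbf 0\})$. (b) If $\mathbb P(\boldsymbol{\mathcal W}_1\in\cdot)\in\mathrm{MRV}(\alpha,b(t),\nu,\mathbb R_+^L\setminus\{\mathbf 0\})\cap\mathrm{MRV}(\alpha_0,b_0(t),\nu_0,\mathbb R_+^L\setminus\mathbb C_0)$ for scaling functions $b(t)\in RV_{1/\alpha}$, $b_0(t)\in RV_{1/\alpha_0}$ with $b(t)/b_0(t)\to\infty$ as $t\to\infty$, limit measures $\nu,\nu_0$, and a closed cone $\mathbb C_0\subset\mathbb R_+^L$, then $\mathbb P(\boldsymbol{\mathcal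 D}_1\in\cdot)\in\mathrm{MRV}(\alpha,b(t),\nu,\mathbb R_+^L\setminus\{\mathbf 0\})\cap\mathrm{MRV}(\alpha_0,b_0(t),\nu_0,\mathbb R_+^L\setminus\mathbb C_0)$.
   Context: $\mathbb R_+^L=[0,\infty)^L$ with the metric $d_p(\mathbf x,\mathbf y)=\|\mathbf x-\mathbf y\|_p$ induced by an $\ell_p$ norm, $p\ge1$. $\mathrm{Poisson}(0)$ is the point mass at $0$. ''Continuous distribution'' means that the joint distribution function is continuous (so no coordinate has atoms). $RV_{\rho}$ is the set of positive functions $b$ with $b(tx)/b(t)\to x^{\rho}$ as $t\to\infty$ for all $x>0$. A closed cone $\mathbb C_0\subset\mathbb R_+^L$ is a nonempty closed set with $\lambda\mathbf x\in\mathbb C_0$ whenever $\mathbf x\in\mathbb C_0$, $\lambda>0$; $\{\mathbf 0\}$ is a closed cone. For a closed cone $\mathbb C_0$, $\mathbb M(\mathbb R_+^L\setminus\mathbb C_0)$ is the set of Borel measures on $\mathbb R_+^L\setminus\mathbb C_0$ that are finite on Borel sets bounded away from $\mathbb C_0$ (i.e. at positive distance from $\mathbb C_0$). Convergence $\mu_t\to\mu$ in $\mathbb M(\mathbb R_+^L\setminus\mathbb C_0)$ means $\int f\,d\mu_t\to\int f\,d\mu$ for every continuous, bounded, nonnegative $f$ on $\mathbb R_+^L\setminus\mathbb C_0$ whose support is bounded away from $\mathbb C_0$. For a random vector $\mathbf Z$ in $\mathbb R_+^L$, $\gamma>0$, $a(t)\in RV_{1/\gamma}$ and a nonzero $\mu\in\mathbb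 M(\mathbb R_+^L\setminus\mathbb C_0)$, the statement $\mathbb P(\mathbf Z\in\cdot)\in\mathrm{MRV}(\gamma,a(t),\mu,\mathbb R_+^L\setminus\mathbb C_0)$ means that $t\,\mathbb P(\mathbf Z/a(t)\in\cdot)\to\mu(\cdot)$ in $\mathbb M(\mathbb R_+^L\setminus\mathbb C_0)$ as $t\to\infty$ (measures restricted to $\mathbb R_+^L\setminus\mathbb C_0$). *)

(* Defs.v *)
From HB Require Import structures.
From mathcomp Require Import all_boot all_order all_algebra.
From mathcomp Require Import all_classical all_reals all_analysis.
From mathcomp Require Import measurable_realfun.
Set Implicit Arguments.
Unset Strict Implicit.
Unset Printing Implicit Defensive.
Import Order.TTheory GRing.Theory Num.Theory.
Import numFieldNormedType.Exports.
Local Open Scope classical_set_scope.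
Local Open Scope ring_scope.

(* R^L with its Borel sigma-algebra.  The carrier is convertible to 'rV[R]_L,
   whose library topology is the one induced by every l_p distance. *)
Notation borel_rV R L := (g_sigma_algebraType (@open 'rV[R]_L)).

Definition orthant (R : realType) (L : nat) : set 'rV[R]_L :=
  [set x | forall l, 0 <= x 0 l].
Arguments orthant : clear implicits.

Definition lp_dist (R : realType) (L : nat) (p : R) (x y : 'rV[R]_L) : R :=
  (\sum_(l < L) `|x 0 l - y 0 l| `^ p) `^ p^-1.

(* The infimum over the empty set is +oo, so set0 is bounded away from C. *)
Definition bounded_away (R : realType) (L : nat) (p : R)
    (C A : set 'rV[R]_L) : Prop :=
  (0 < ereal_inf [set (lp_dist p x y)%:E | x in A & y in C])%E.

Definition closed_cone (R : realType) (L : nat) (C : set 'rV[R]_L) : Prop :=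
  [/\ C !=set0, C `<=` orthant R L, closed C &
      forall (lam : R) (x : 'rV[R]_L), 0 < lam -> C x -> C (lam *: x)].

Definition regularly_varying (R : realType) (rho : R) (b : R -> R) : Prop :=
  (forall t, 0 < t -> 0 < b t) /\
  (forall x, 0 < x -> b (t * x) / b t @[t --> +oo] --> x `^ rho).

(* Membership of mu in M(R_+^L \ C).  A Borel measure on the Borel subspace
   R_+^L \ C is encoded as a Borel measure on R^L that vanishes off it. *)
Definition Mspace (R : realType) (L : nat) (p : R) (C : set 'rV[R]_L)
    (mu : {measure set (borel_rV R L) -> \bar R}) : Prop :=
  mu (~` (orthant R L `\` C)) = 0%E /\
  forall A : set (borel_rV R L), measurable A -> A `<=` orthant R L `\` C ->
    bounded_away p C A -> (mu A < +oo)%E.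

(* Only the values of f on R_+^L \ C matter; the support is the closure of
   {f != 0} relative to R_+^L \ C. *)
Definition Mtest (R : realType) (L : nat) (p : R) (C : set 'rV[R]_L)
    (f : 'rV[R]_L -> R) : Prop :=
  let E := orthant R L `\` C in
  [/\ {within E, continuous f},
      (forall x, E x -> 0 <= f x),
      (exists K : R, forall x, E x -> f x <= K) &
      bounded_away p C (E `&` closure [set x | E x /\ f x != 0])].

(* Convergence in M(R_+^L \ C); mu_ t need not vanish off R_+^L \ C, it is
   only used through its restriction to that set. *)
Definition Mcvg (R : realType) (L : nat) (p : R) (C : set 'rV[R]_L)
    (mu_ : R -> set (borel_rV R L) -> \bar R)
    (mu : {measure set (borel_rV R L) -> \bar R}) : Prop :=
  let E := orthant R L `\` C in
  forall f : 'rV[R]_L -> R, Mtest p C f ->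
    (\int[mu_ t]_(x in E) (f x)%:E)%E @[t --> +oo] -->
    (\int[mu]_(x in E) (f x)%:E)%E.

Definition scaled_law (R : realType) (L : nat) (d : measure_display)
    (T : measurableType d) (P : probability T R) (Z : T -> 'rV[R]_L)
    (a : R -> R) (t : R) : set (borel_rV R L) -> \bar R :=
  fun A => (t%:E * P [set w | A ((a t)^-1 *: Z w)])%E.

Definition MRV (R : realType) (L : nat) (p : R) (d : measure_display)
    (T : measurableType d) (P : probability T R) (Z : T -> 'rV[R]_L)
    (gamma : R) (a : R -> R) (mu : {measure set (borel_rV R L) -> \bar R})
    (C : set 'rV[R]_L) : Prop :=
  [/\ 0 < gamma,
      regularly_varying gamma^-1 a,
      Mspace p C mu,
      mu setT != 0%E &
      Mcvg p C (scaled_law P Z a) mu].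

(* Joint distribution function x |-> P(Z_1 <= x_1, ..., Z_L <= x_L). *)
Definition continuous_distribution (R : realType) (L : nat)
    (d : measure_display) (T : measurableType d) (P : probability T R)
    (Z : T -> 'rV[R]_L) : Prop :=
  continuous (fun x : 'rV[R]_L => P [set w | forall l, Z w 0 l <= x 0 l]).

(* The Poisson distribution as a set function on R.  The second argument of the
   library's poisson_prob is a dummy, and poisson_prob 0 is the point mass
   at 0. *)
Definition poisson_law (R : realType) (r : R) (A : set R) : \bar R :=
  poisson_prob r 0%N [set k : nat | A k%:R].

(* h o X is a version of the conditional probability of B given X. *)
Definition is_cond_prob (R : realType) (L : nat) (d : measure_display)
    (T : measurableType d) (P : probability T R) (X : T -> 'rV[R]_L)
    (B : set T) (h : borel_rV R L -> \bar R) : Prop :=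
  measurable_fun setT h /\
  forall A : set (borel_rV R L), measurable A ->
    P (B `&` X @^-1` A) = (\int[P]_(w in X @^-1` A) h (X w))%E.

(* Given X, the entries of Y are independent and Y_l ~ Poisson(c_l X_l): the
   conditional law of Y given X is the product of the Poisson(c_l X_l). *)
Definition cond_indep_poisson (R : realType) (L : nat) (d : measure_display)
    (T : measurableType d) (P : probability T R) (c : 'I_L -> R)
    (X Y : T -> 'rV[R]_L) : Prop :=
  forall A : 'I_L -> set R, (forall l, measurable (A l)) ->
    is_cond_prob P X [set w | forall l, A l (Y w 0 l)]
      (fun x : 'rV[R]_L =>
         (\prod_(l < L) poisson_law (c l * x 0 l)%R (A l))%E).

(* Main.v *)
Require Import Defs.
From HB Require Import structures.
From mathcomp Require Import all_boot all_order all_algebra.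
From mathcomp Require Import all_classical all_reals all_analysis.
From mathcomp Require Import measurable_realfun ring lra.
Import Order.TTheory GRing.Theory Num.Theory.
Import numFieldNormedType.Exports.
Local Open Scope classical_set_scope.
Local Open Scope ring_scope.

(** Write [Z] for the vector of the [c_l W_l]. Given [W], the deviation
[D_l - Z_l] has size about [sqrt Z_l]. At probability level [1/t] the vector
[Z] is of order [b t], about [t^(1/alpha)], so [D - Z] is of order
[t^(1/(2 alpha))]; this is small compared with [b0 t], about [t^(1/alpha0)],
exactly because [alpha0 < 2 alpha]. Hence [Z / b0 t] and [D / b0 t] are
within [delta] of each other outside an event of probability [o(1/t)], and the
two scaled laws have the same limit away from any closed cone. Part (a) is the
case where the second cone is [{0}] and the second scaling function is [b], so
that a single transfer lemma, [poisson_Mcvg], yields both parts.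

The exceptional event is handled by a cut of [Z_l] at [u = (b0 t)^s] for some
[s < 2]. Above [u], the tail of [|Z|] decays like [y^(- beta)] for every
[beta < alpha] ([MRV_norm_tail_le_powR]) and [b0] grows at least like [t^eta]
for every [eta < 1/alpha0] ([MRV_scaling_ge_powR]), so [t P(|Z| >= u)] is at
most of order [t^(1 - eta s beta)]; the exponents can be chosen with
[eta s beta > 1] since [2 alpha / alpha0 > 1]. Below [u], Chernoff's bound
with parameter [u^(-1/2)] ([poisson_chernoff]) makes the probability of a
deviation [delta (b0 t)] at most a constant times
[exp (- delta (b0 t)^(1 - s/2))], which beats every power of [t]. The two
estimates are put together in [poisson_bad_negligible].

Regular variation is a pointwise condition here and the scaling functions may
fail to be measurable, so that Potter's bounds are out of reach. Both growth
estimates use instead the single ratio [b (2 t) / b t], iterated along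
doublings; the missing control between two doublings comes from the
monotonicity of the tail of [Z], or from a crude lower bound on [b] deduced
from a tail probability that is positive.

What remains is to compare the integrals of a test function [f] at [D / b0 t]
and [Z / b0 t]. Off the exceptional event they agree unless [Z / b0 t] is away
from the cone, which has probability [O(1/t)]. There [f] is uniformly
continuous on bounded sets, and the unbounded part carries little mass, because
the tail sets of the limit measure shrink to the empty set
([scaled_tail_tight]). *)

(** * Distance to a cone *)

Definition dist_to {R : realType} {V : normedModType R} (C : set V) (x : V) : R :=
  inf [set `|x - y| | y in C].

Lemma dist_to_le {R : realType} {V : normedModType R} (C : set V) (x y : V) :
  C y -> dist_to C x <= `|x - y|.
Proof.
move=> Cy; apply: ge_inf; last by exists y.
by exists 0 => _ [z _ <-]; exact: normr_ge0.
Qed.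

Lemma le_dist_to {R : realType} {V : normedModType R} (C : set V) (x : V) (r : R) :
  C !=set0 -> (forall y, C y -> r <= `|x - y|) -> r <= dist_to C x.
Proof.
move=> [y0 Cy0] h; apply: lb_le_inf; first by exists `|x - y0|, y0.
by move=> _ [y Cy <-]; exact: h.
Qed.

Lemma dist_to_ge0 {R : realType} {V : normedModType R} (C : set V) (x : V) :
  C !=set0 -> 0 <= dist_to C x.
Proof. by move=> C0; apply: le_dist_to. Qed.

(** Lipschitz continuity is used twice: for the
    measurability of tail sets, and to move a point away from the cone by
    [delta] without losing more than [delta] of its distance. *)
Lemma dist_to_lip {R : realType} {V : normedModType R} (C : set V) (x y : V) :
  C !=set0 -> dist_to C x <= dist_to C y + `|x - y|.
Proof.
move=> C0; rewrite -lerBlDr; apply: le_dist_to => // z Cz.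
rewrite lerBlDr (le_trans (dist_to_le _ _ _ Cz))// [leRHS]addrC.
exact: ler_distD.
Qed.

Lemma dist_to_continuous {R : realType} {V : normedModType R} (C : set V) :
  C !=set0 -> continuous (dist_to C).
Proof.
move=> C0 x; apply/cvgrPdist_le => e e0; near=> y.
have xy : `|x - y| <= e by near: y; exact: cvgr_dist_le.
rewrite ler_norml; apply/andP; split.
  by rewrite lerBrDr addrC lerBlDr (le_trans (dist_to_lip _ _ x C0))// lerD2l distrC.
by rewrite lerBlDl (le_trans (dist_to_lip _ _ y C0))// lerD2l.
Unshelve. all: by end_near. Qed.

Lemma dist_to_gt0 {R : realType} {V : normedModType R} (C : set V) (x : V) :
  C !=set0 -> closed C -> ~ C x -> 0 < dist_to C x.
Proof.
move=> C0 cC nCx.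
have : nbhs x (~` C) by apply: open_nbhs_nbhs; split => //; exact: closed_openC.
move/nbhs_ballP => [e /= e0 eC]; apply: lt_le_trans e0 _.
apply: le_dist_to => // y Cy; rewrite leNgt; apply/negP => xy.
by apply: (eC y) => //; rewrite -ball_normE.
Qed.

Lemma dist_to_eq0 {R : realType} {V : normedModType R} (C : set V) (x : V) :
  C x -> dist_to C x = 0.
Proof.
move=> Cx; apply/le_anti; rewrite dist_to_ge0 ?andbT; last by exists x.
by rewrite (le_trans (dist_to_le _ _ _ Cx))// subrr normr0.
Qed.

(** Homogeneity comes from the invariance of the cone; it lets the tail sets
    of a rescaled vector be read as tail sets of the vector at another level. *)
Lemma dist_toZ {R : realType} {V : normedModType R} (C : set V) (k : R) (x : V) :
  C !=set0 -> (forall k y, 0 < k -> C y -> C (k *: y)) ->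
  0 < k -> dist_to C (k *: x) = k * dist_to C x.
Proof.
move=> C0 coneC.
have le_dist (j : R) (z : V) : 0 < j -> j * dist_to C z <= dist_to C (j *: z).
  move=> j0; apply: le_dist_to => // y Cy.
  rewrite -[y](scalerKV (lt0r_neq0 j0)) -scalerBr normrZ gtr0_norm// ler_pM2l//.
  by apply/dist_to_le/coneC => //; rewrite invr_gt0.
move=> k0; apply/le_anti; rewrite le_dist// andbT.
rewrite -ler_pdivrMl//; apply: le_trans (le_dist _ _ _) _; first by rewrite invr_gt0.
by rewrite scalerK// lt0r_neq0.
Qed.

Lemma dist_to0 {R : realType} {V : normedModType R} (x : V) :
  dist_to [set 0] x = `|x|.
Proof.
apply/le_anti/andP; split.
  by rewrite (le_trans (dist_to_le _ _ 0 _))// subr0.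
by apply: le_dist_to; [exists 0|move=> y ->; rewrite subr0].
Qed.

Lemma closed_cone_set0 {R : realType} {L : nat} : closed_cone [set (0 : 'rV[R]_L)].
Proof.
split; first by exists 0.
- by move=> x -> l; rewrite mxE.
- exact/accessible_closed_set1/hausdorff_accessible/norm_hausdorff.
- by move=> k x _ ->; exact: scaler0.
Qed.

Lemma ler_coord_norm {R : realType} {L : nat} (x : 'rV[R]_L) l : `|x 0 l| <= `|x|.
Proof.
by rewrite [leRHS]mx_normrE (le_bigmax _ _ (0, l)).
Qed.

Lemma ler_norm_coord {R : realType} {L : nat} (x : 'rV[R]_L) (r : R) :
  0 <= r -> (forall l, `|x 0 l| <= r) -> `|x| <= r.
Proof.
move=> r0 h; rewrite [leLHS]mx_normrE; apply/bigmax_leP; split => // -[i l] _.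
by rewrite (ord1 i) /= h.
Qed.

Lemma ler_norm_lp_dist {R : realType} {L : nat} (p : R) (x y : 'rV[R]_L) :
  1 <= p -> `|x - y| <= lp_dist p x y.
Proof.
move=> p1; have p0 : 0 < p by exact: lt_le_trans p1.
apply: ler_norm_coord => [|l]; first exact: powR_ge0.
rewrite !mxE /lp_dist -[leLHS]powRr1// -(divff (lt0r_neq0 p0)) powRrM.
apply: ge0_ler_powR; rewrite ?nnegrE ?invr_ge0 ?powR_ge0 ?(ltW p0)//.
  by apply: sumr_ge0 => i _; exact: powR_ge0.
by rewrite (bigD1 l)//= lerDl; apply: sumr_ge0 => i _; exact: powR_ge0.
Qed.

Lemma lp_dist_le_norm {R : realType} {L : nat} (p : R) (x y : 'rV[R]_L) :
  1 <= p -> lp_dist p x y <= L%:R `^ p^-1 * `|x - y|.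
Proof.
move=> p1; have p0 : 0 < p by exact: lt_le_trans p1.
have -> : `|x - y| = (`|x - y| `^ p) `^ p^-1.
  by rewrite -powRrM divff ?lt0r_neq0// powRr1.
rewrite /lp_dist -powRM ?powR_ge0//.
apply: ge0_ler_powR; rewrite ?nnegrE ?invr_ge0 ?mulr_ge0 ?powR_ge0 ?(ltW p0)//.
  by apply: sumr_ge0 => i _; exact: powR_ge0.
rewrite mulr_natl -[X in _ *+ X]card_ord -sumr_const; apply: ler_sum => l _.
apply: ge0_ler_powR; rewrite ?nnegrE ?(ltW p0)//.
by have := ler_coord_norm (x - y) l; rewrite !mxE.
Qed.

(** Each [l_p] distance and the maximum norm are comparable, with constants
    depending on [L] and [p] only, so that being bounded away from [C] can be
    tested with the distance to [C] in the maximum norm. *)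
Lemma bounded_awayP {R : realType} {L : nat} (p : R) (C A : set 'rV[R]_L) :
  (0 < L)%N -> 1 <= p -> C !=set0 ->
  bounded_away p C A <-> exists2 r, 0 < r & forall x, A x -> r <= dist_to C x.
Proof.
move=> L0 p1 C0; have K0 : 0 < L%:R `^ p^-1 :> R by rewrite powR_gt0// ltr0n.
split=> [h|[r r0 h]]; last first.
  apply: lt_le_trans (_ : (0 < r%:E)%E) _; first by rewrite lte_fin.
  apply/ereal_infP => _ [x Ax] [y Cy] <-; rewrite lee_fin.
  apply: le_trans (h _ Ax) _; apply: le_trans (dist_to_le _ _ _ Cy) _.
  exact: ler_norm_lp_dist.
have [r r0 hr] : exists2 r : R, 0 < r &
    (r%:E <= ereal_inf [set (lp_dist p x y)%:E | x in A & y in C])%E.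
  move: h; rewrite /bounded_away; case: (ereal_inf _) => [r| |]//= r0.
    by exists r.
  by exists 1; rewrite ?ltr01// leey.
exists (r / (L%:R `^ p^-1)); first by rewrite divr_gt0.
move=> x Ax; apply: le_dist_to => // y Cy; rewrite ler_pdivrMr// mulrC.
apply: le_trans _ (lp_dist_le_norm _ _ _ p1).
by move/ereal_infP : hr => /(_ _ (ex_intro2 _ _ x Ax (ex_intro2 _ _ y Cy erefl))).
Qed.

(** A one-sided form of the Heine-Cantor theorem: the second point ranges over
    all of [O], because the Poisson vector close to a bounded vector may leave
    the compact set. *)
Lemma uniformly_continuous_compact {R : realType} {V : normedModType R}
    (K O : set V) (g : V -> R) (e : R) : 0 < e ->
  compact K -> K `<=` O ->
  (forall x, O x -> forall e, 0 < e -> \forall y \near x, O y -> `|g x - g y| < e) ->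
  exists2 r, 0 < r &
    forall x y, K x -> O y -> `|x - y| <= r -> `|g x - g y| <= e.
Proof.
move=> e0 cK KO gc.
pose P (r : R) (x : V) := K x -> forall y, O y -> `|x - y| <= r -> `|g x - g y| <= e.
have : near_covering K by exact/compact_near_coveringP.
move=> /(_ _ (0 : R)^'+ P _) [x Kx|].
  have e20 : 0 < e / 2 by rewrite divr_gt0.
  have /nbhs_ballP[r /= r0 rP] := gc _ (KO _ Kx) _ e20.
  have r20 : 0 < r / 2 by rewrite divr_gt0.
  exists (ball x (r / 2), [set s | s < r / 2]) => /=.
    split; first exact: nbhsx_ballx.
    exact: nbhs_right_lt.
  move=> [x' s] /= [xx' sr] Kx' y Oy x'y.
  have xx'' : `|x - x'| < r / 2 by move: xx'; rewrite -ball_normE.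
  have h1 : `|g x - g x'| < e / 2.
    apply: rP; last exact: KO.
    by rewrite -ball_normE/= (lt_trans xx'')// gtr_pMr ?invf_lt1// ltr1n.
  have h2 : `|g x - g y| < e / 2.
    apply: rP => //; rewrite -ball_normE/= (splitr r).
    by rewrite (le_lt_trans (ler_distD x' _ _))// ltrD// (le_lt_trans x'y).
  rewrite (le_trans (ler_distD (g x) _ _))// [leRHS]splitr lerD// ltW//.
  by rewrite distrC.
move=> s /= s0 hs; exists (s / 2); first by rewrite divr_gt0.
move=> x y Kx Oy xy.
have s20 : 0 < s / 2 by rewrite divr_gt0.
apply: (hs (s / 2)) => //=.
by rewrite sub0r normrN gtr0_norm// gtr_pMr ?invf_lt1// ltr1n.
Qed.

(** * Borel measurability and scaled laws *)

Lemma closed_borel {R : realType} {L : nat} (A : set 'rV[R]_L) :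
  closed A -> measurable (A : set (borel_rV R L)).
Proof.
move=> cA; rewrite -[A]setCK; apply: measurableC.
by apply: sub_sigma_algebra; exact: closed_openC.
Qed.

Lemma within_continuous_borel {R : realType} {L : nat} (E : set 'rV[R]_L)
    (f : 'rV[R]_L -> R) :
  measurable (E : set (borel_rV R L)) -> {within E, continuous f} ->
  measurable_fun (E : set (borel_rV R L)) (f : borel_rV R L -> R).
Proof.
move=> mE /continuousP cf; apply: (measurability _ (RGenOpens.measurableE R)).
move=> _ [_ [a [b ->] <-]].
have /open_subspaceP[V oV VE] := cf _ (@interval_open _ (BRight a) (BLeft b) isT isT).
rewrite [X in measurable X](_ : _ = V `&` E); last by rewrite VE setIC.
by apply: measurableI => //; exact: sub_sigma_algebra.
Qed.

Lemma continuous_borel {R : realType} {L : nat} (f : 'rV[R]_L -> R) :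
  continuous f -> measurable_fun setT (f : borel_rV R L -> R).
Proof.
move=> cf; apply: within_continuous_borel; first exact: measurableT.
exact: continuous_subspaceT.
Qed.

Lemma continuous_borel_rV {R : realType} {L M : nat} (f : 'rV[R]_L -> 'rV[R]_M) :
  continuous f -> measurable_fun setT (f : borel_rV R L -> borel_rV R M).
Proof.
move=> /continuousP cf; apply: (@measurability _ _ (borel_rV R L) (borel_rV R M)
  _ _ (@open 'rV[R]_M) erefl).
by move=> _ [B oB <-]; rewrite setTI; apply: sub_sigma_algebra; exact: cf.
Qed.

Lemma orthant_closed {R : realType} {L : nat} : closed (orthant R L).
Proof.
have -> : orthant R L = \bigcap_l [set x : 'rV[R]_L | 0 <= x 0 l].
  by apply/seteqP; split => [x h l _|x h l]; exact: h.
apply: closed_bigI => l _.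
apply: (@preimage_closed _ _ (fun x : 'rV[R]_L => x 0 l) [set y | 0 <= y]).
  by move=> x _; exact: coord_continuous.
exact: closed_ge.
Qed.

Lemma scale_measurable {R : realType} {L : nat} {d : measure_display}
    {T : measurableType d} (Z : T -> 'rV[R]_L) (k : R) :
  measurable_fun setT (Z : T -> borel_rV R L) ->
  measurable_fun setT ((fun w => k *: Z w) : T -> borel_rV R L).
Proof.
move=> mZ; apply: (measurableT_comp (f := ( *:%R k) : borel_rV R L -> borel_rV R L)) => //.
by apply: continuous_borel_rV => x; exact: scaler_continuous.
Qed.

Lemma restrict_borel {R : realType} {L : nat} (E : set 'rV[R]_L)
    (f : 'rV[R]_L -> R) :
  measurable (E : set (borel_rV R L)) -> {within E, continuous f} ->
  measurable_fun setT ((f \_ E) : borel_rV R L -> R).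
Proof.
move=> mE cf; apply/(measurable_restrictT _ mE); exact: within_continuous_borel.
Qed.

(** For [0 < t] the scaled law is [t] times a pushforward, hence a measure, and
    integrals against it are expectations. *)
Lemma integral_scaled_law {R : realType} {L : nat} {d : measure_display}
    {T : measurableType d} (P : probability T R) (Z : T -> 'rV[R]_L)
    (a : R -> R) (t : R) (E : set 'rV[R]_L) (f : 'rV[R]_L -> R) :
  measurable_fun setT (Z : T -> borel_rV R L) ->
  measurable (E : set (borel_rV R L)) -> {within E, continuous f} ->
  (forall x, E x -> 0 <= f x) -> 0 < t ->
  (\int[scaled_law P Z a t]_(x in E) (f x)%:E)%E =
  (t%:E * \int[P]_w ((f \_ E) ((a t)^-1 *: Z w))%:E)%E.
Proof.
move=> mZ mE cf f0 t0.
pose phi : T -> borel_rV R L := fun w => (a t)^-1 *: Z w.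
have mphi : measurable_fun setT phi by exact: scale_measurable.
have -> : scaled_law P Z a t = mscale (NngNum (ltW t0)) (pushforward P phi) by [].
have mf := restrict_borel _ _ mE cf.
have f0' x : (0 <= ((f \_ E) x)%:E)%E.
  by rewrite lee_fin patchE; case: ifPn => // /set_mem; exact: f0.
rewrite integral_mkcond [LHS](_ : _ =
    (\int[mscale (NngNum (ltW t0)) (pushforward P phi)]_x ((f \_ E) x)%:E)%E); last first.
  by apply: eq_integral => x _; rewrite restrict_EFin.
rewrite ge0_integral_mscale//=; last by apply/measurable_EFinP.
by rewrite ge0_integral_pushforward//; apply/measurable_EFinP.
Qed.

(** * Tails of multivariate regularly varying vectors *)

Lemma measure_le_integral {d : measure_display} {T : measurableType d}
    {R : realType} (mu : {measure set T -> \bar R}) (A : set T) (h : T -> R) :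
  measurable A -> measurable_fun setT h -> (forall x, 0 <= h x) ->
  (forall x, A x -> 1 <= h x) -> (mu A <= \int[mu]_x (h x)%:E)%E.
Proof.
move=> mA mh h0 h1; rewrite -(setIT A) -integral_indic//.
apply: ge0_le_integral => //.
- by apply/measurable_EFinP; exact: measurable_indic.
- exact/measurable_EFinP.
- move=> x _; rewrite lee_fin indicE; case: (boolP (x \in A)) => // /set_mem.
  exact: h1.
Qed.

Lemma integral_le_measure {d : measure_display} {T : measurableType d}
    {R : realType} (mu : {measure set T -> \bar R}) (E A : set T) (h : T -> R) :
  measurable E -> measurable A -> A `<=` E -> measurable_fun E h ->
  (forall x, E x -> 0 <= h x <= 1) ->
  (forall x, E x -> h x != 0 -> A x) -> (\int[mu]_(x in E) (h x)%:E <= mu A)%E.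
Proof.
move=> mE mA AE mh h01 hA; rewrite -(setIidl AE) -integral_indic//.
apply: ge0_le_integral => //.
- by move=> x /h01/andP[h0 _]; rewrite lee_fin.
- by apply/measurable_EFinP.
- by apply/measurable_EFinP; exact: measurable_indic.
- move=> x Ex; rewrite lee_fin indicE.
  case: (eqVneq (h x) 0) => [->//|hx]; have /andP[_ h1] := h01 _ Ex.
  by rewrite mem_set//; exact: hA.
Qed.

Definition clamp {R : realType} (x : R) : R := Num.min 1 (Num.max 0 x).

Lemma clamp_itv {R : realType} (x : R) : 0 <= clamp x <= 1.
Proof. by rewrite /clamp le_min ler01 le_max lexx /= ge_min lexx. Qed.

Lemma clamp_ge1 {R : realType} (x : R) : 1 <= x -> clamp x = 1.
Proof. by move=> x1; apply/min_idPl; rewrite le_max x1 orbT. Qed.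

Lemma clamp_neq0 {R : realType} (x : R) : clamp x != 0 -> 0 < x.
Proof.
rewrite ltNge; apply: contra => x0.
by rewrite /clamp (max_idPl x0) min_r.
Qed.

Lemma clamp_continuous {R : realType} : continuous (@clamp R).
Proof.
move=> x; apply: continuous_min; first exact: cvg_cst.
by apply: continuous_max; [exact: cvg_cst|exact: cvg_id].
Qed.

(** A continuous function squeezed, on the orthant, between the indicators of the tail sets at
    levels [(r, M + 1)] and [(r / 2, M)]. The second factor allows the same
    function to serve for tightness. *)
Definition tail_test {R : realType} {L : nat} (C : set 'rV[R]_L) (r M : R)
    (x : 'rV[R]_L) : R :=
  clamp (2 / r * dist_to C x - 1) * clamp (`|x| - M).

Definition tail_set {R : realType} {L : nat} (C : set 'rV[R]_L) (r M : R) :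
    set 'rV[R]_L :=
  [set x | [/\ orthant R L x, r <= dist_to C x & M <= `|x|]].

Lemma tail_test_itv {R : realType} {L : nat} (C : set 'rV[R]_L) (r M : R) x :
  0 <= tail_test C r M x <= 1.
Proof.
have /andP[a0 a1] := clamp_itv (2 / r * dist_to C x - 1).
have /andP[b0 b1] := clamp_itv (`|x| - M).
by rewrite /tail_test mulr_ge0// mulr_ile1.
Qed.

Lemma tail_test_neq0 {R : realType} {L : nat} (C : set 'rV[R]_L) (r M : R) x :
  0 < r -> tail_test C r M x != 0 -> r / 2 <= dist_to C x /\ M <= `|x|.
Proof.
move=> r0; rewrite /tail_test mulf_eq0 negb_or => /andP[/clamp_neq0 h1 /clamp_neq0].
rewrite subr_gt0 => /ltW ->; split => //; rewrite ler_pdivrMr//.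
by move: h1; rewrite subr_gt0 mulrAC ltr_pdivlMr// mul1r mulrC => /ltW.
Qed.

Lemma tail_test_eq1 {R : realType} {L : nat} (C : set 'rV[R]_L) (r M : R) x :
  0 < r -> r <= dist_to C x -> M + 1 <= `|x| -> tail_test C r M x = 1.
Proof.
move=> r0 rx Mx; rewrite /tail_test !clamp_ge1 ?mulr1//.
  by rewrite lerBrDr addrC.
rewrite lerBrDr mulrAC ler_pdivlMr//.
by rewrite (_ : 1 + 1 = 2)// ler_pM2l.
Qed.

Lemma tail_test_continuous {R : realType} {L : nat} (C : set 'rV[R]_L) (r M : R) :
  C !=set0 -> continuous (tail_test C r M).
Proof.
move=> C0 x; apply: (@continuousM _ _ (clamp \o (fun x => 2 / r * dist_to C x - 1))
    (clamp \o (fun x => `|x| - M))).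
  apply: continuous_comp; last exact: clamp_continuous.
  apply: (@continuousB _ _ _ (fun x => 2 / r * dist_to C x) (fun=> 1)); last exact: cst_continuous.
  apply: (@continuousM _ _ (fun=> 2 / r) (dist_to C)); first exact: cst_continuous.
  exact: dist_to_continuous.
apply: continuous_comp; last exact: clamp_continuous.
apply: (@continuousB _ _ _ (fun x : 'rV[R]_L => `|x|) (fun=> M)); last exact: cst_continuous.
exact: norm_continuous.
Qed.

Lemma tail_test_Mtest {R : realType} {L : nat} (p : R) (C : set 'rV[R]_L) (r M : R) :
  (0 < L)%N -> 1 <= p -> C !=set0 -> 0 < r -> Mtest p C (tail_test C r M).
Proof.
move=> L0 p1 C0 r0; split.
- by apply: continuous_subspaceT; exact: tail_test_continuous.
- by move=> x _; have /andP[] := tail_test_itv C r M x.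
- by exists 1 => x _; have /andP[] := tail_test_itv C r M x.
- apply/bounded_awayP => //; exists (r / 2); first by rewrite divr_gt0.
  move=> x [_]; rewrite closureEbigcap.
  move=> /(_ [set x | r / 2 <= dist_to C x]); apply; split.
    apply: (@preimage_closed _ _ (dist_to C) [set y | r / 2 <= y]).
      by move=> y _; exact: dist_to_continuous.
    exact: closed_ge.
  by move=> y [_ /(tail_test_neq0 _ _ _ _ r0)[]].
Qed.

Lemma tail_set_closed {R : realType} {L : nat} (C : set 'rV[R]_L) (r M : R) :
  C !=set0 -> closed (tail_set C r M).
Proof.
move=> C0.
have -> : tail_set C r M = orthant R L `&`
    (dist_to C @^-1` [set y | r <= y] `&` (fun x : 'rV[R]_L => `|x|) @^-1` [set y | M <= y]).
  by apply/seteqP; split => x /=; [case|case=> ? []].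
apply: closedI; first exact: orthant_closed.
apply: closedI; (apply: preimage_closed; last exact: closed_ge) => x _.
  exact: dist_to_continuous.
exact: norm_continuous.
Qed.

Lemma cone_complement_borel {R : realType} {L : nat} (C : set 'rV[R]_L) :
  closed C -> measurable (orthant R L `\` C : set (borel_rV R L)).
Proof.
by move=> cC; apply: measurableD; apply: closed_borel => //; exact: orthant_closed.
Qed.

Lemma tail_set_sub {R : realType} {L : nat} (C : set 'rV[R]_L) (r M : R) :
  0 < r -> tail_set C r M `<=` orthant R L `\` C.
Proof.
move=> r0 x [Ox rx _]; split => // Cx.
by move: rx; rewrite dist_to_eq0// leNgt r0.
Qed.

Lemma tail_set_finite {R : realType} {L : nat} (p : R) (C : set 'rV[R]_L)
    (mu : {measure set (borel_rV R L) -> \bar R}) (r M : R) :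
  (0 < L)%N -> 1 <= p -> C !=set0 -> 0 < r -> Mspace p C mu ->
  (mu (tail_set C r M) < +oo)%E.
Proof.
move=> L0 p1 C0 r0 [_]; apply.
- by apply: closed_borel; exact: tail_set_closed.
- exact: tail_set_sub.
- by apply/bounded_awayP => //; exists r => // x [].
Qed.

(** One half of the portmanteau theorem for tail sets, by the squeeze through
    [tail_test]. *)
Lemma scaled_tail_le {R : realType} {L : nat} (p : R) {d : measure_display}
    {T : measurableType d} (P : probability T R) (Z : T -> 'rV[R]_L)
    (a : R -> R) (C : set 'rV[R]_L)
    (mu : {measure set (borel_rV R L) -> \bar R}) (r M K : R) :
  (0 < L)%N -> 1 <= p -> C !=set0 -> closed C -> 0 < r ->
  measurable_fun setT (Z : T -> borel_rV R L) ->
  Mcvg p C (scaled_law P Z a) mu ->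
  (mu (tail_set C (r / 2) M) < K%:E)%E ->
  \forall t \near +oo,
    (t%:E * P [set w | tail_set C r (M + 1) ((a t)^-1 *: Z w)] <= K%:E)%E.
Proof.
move=> L0 p1 C0 cC r0 mZ hcvg muK.
have mE := cone_complement_borel _ cC.
have ctt := tail_test_continuous C r M C0.
have tt0 x : 0 <= tail_test C r M x by have /andP[] := tail_test_itv C r M x.
have r20 : 0 < r / 2 by rewrite divr_gt0.
have limK : (\int[mu]_(x in orthant R L `\` C) (tail_test C r M x)%:E < K%:E)%E.
  apply: le_lt_trans muK; apply: integral_le_measure => //.
  - by apply: closed_borel; exact: tail_set_closed.
  - exact: tail_set_sub.
  - by apply: measurable_funTS; exact: continuous_borel.
  - by move=> x _; exact: tail_test_itv.
  - by move=> x [Ox _] /(tail_test_neq0 _ _ _ _ r0)[].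
have := hcvg _ (tail_test_Mtest p _ r M L0 p1 C0 r0).
move=> /(_ [set y | (y < K%:E)%E]) /=.
have : nbhs (\int[mu]_(x in orthant R L `\` C) (tail_test C r M x)%:E)%E
    [set y | (y < K%:E)%E].
  by apply: open_nbhs_nbhs; split => //; exact: open_ereal_lt_ereal.
move=> nK /(_ nK) evK; near=> t.
have t0 : 0 < t by near: t; exact: nbhs_pinfty_gt.
apply: le_trans (ltW (_ : (\int[scaled_law P Z a t]_(x in orthant R L `\` C)
  (tail_test C r M x)%:E < K%:E)%E)); last by near: t.
rewrite integral_scaled_law//; last exact: continuous_subspaceT.
apply: lee_wpmul2l; first by rewrite lee_fin ltW.
have msc := scale_measurable Z (a t)^-1 mZ.
apply: measure_le_integral.
- rewrite -[X in measurable X]setTI; apply: (msc measurableT).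
  by apply: closed_borel; exact: tail_set_closed.
- apply: (measurableT_comp (f := (tail_test C r M \_ (orthant R L `\` C)) : borel_rV R L -> R)) => //.
  by apply: restrict_borel => //; exact: continuous_subspaceT.
- by move=> w; rewrite patchE; case: ifPn.
- move=> w /= hw; rewrite patchE mem_set; last exact: tail_set_sub hw.
  by case: hw => Ow rw Mw; rewrite tail_test_eq1.
Unshelve. all: by end_near. Qed.

Lemma scaled_tail_bounded {R : realType} {L : nat} (p : R) {d : measure_display}
    {T : measurableType d} (P : probability T R) (Z : T -> 'rV[R]_L)
    (a : R -> R) (C : set 'rV[R]_L)
    (mu : {measure set (borel_rV R L) -> \bar R}) (r : R) :
  (0 < L)%N -> 1 <= p -> C !=set0 -> closed C -> 0 < r ->
  measurable_fun setT (Z : T -> borel_rV R L) ->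
  Mspace p C mu -> Mcvg p C (scaled_law P Z a) mu ->
  exists K : R, \forall t \near +oo,
    (t%:E * P [set w | tail_set C r 0 ((a t)^-1 *: Z w)] <= K%:E)%E.
Proof.
move=> L0 p1 C0 cC r0 mZ hmu hcvg.
have r20 : 0 < r / 2 by rewrite divr_gt0.
have fin := tail_set_finite p C mu (r / 2) (-1) L0 p1 C0 r20 hmu.
(* Level -1 for the norm, since the squeeze costs 1 and level 0 is no constraint. *)
exists (fine (mu (tail_set C (r / 2) (-1))) + 1).
rewrite -(subrr (1 : R)) [1 - 1]addrC.
apply: (scaled_tail_le p _ _ _ _ mu) => //.
rewrite EFinD fineK ?ge0_fin_numE// lteDl// ?lte_fin//.
by rewrite ge0_fin_numE.
Qed.

(** The tail sets decrease to the empty set as [M] grows and have finite limit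
    mass, so this mass tends to [0]. *)
Lemma scaled_tail_tight {R : realType} {L : nat} (p : R) {d : measure_display}
    {T : measurableType d} (P : probability T R) (Z : T -> 'rV[R]_L)
    (a : R -> R) (C : set 'rV[R]_L)
    (mu : {measure set (borel_rV R L) -> \bar R}) (r e : R) :
  (0 < L)%N -> 1 <= p -> C !=set0 -> closed C -> 0 < r -> 0 < e ->
  measurable_fun setT (Z : T -> borel_rV R L) ->
  Mspace p C mu -> Mcvg p C (scaled_law P Z a) mu ->
  exists2 M : R, 0 < M & \forall t \near +oo,
    (t%:E * P [set w | tail_set C r M ((a t)^-1 *: Z w)] <= e%:E)%E.
Proof.
move=> L0 p1 C0 cC r0 e0 mZ hmu hcvg.
have r20 : 0 < r / 2 by rewrite divr_gt0.
pose F n : set (borel_rV R L) := tail_set C (r / 2) n%:R.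
have mF n : measurable (F n) by apply: closed_borel; exact: tail_set_closed.
have F0 : \bigcap_n F n = set0.
  apply/seteqP; split => // x hx.
  have [_ _] := hx (Num.bound `|x|) Logic.I.
  by rewrite leNgt archi_boundP.
have cF : (mu \o F) n @[n --> \oo] --> 0%E.
  rewrite -(measure0 mu) -F0; apply: nonincreasing_cvg_mu => //.
  - exact: (tail_set_finite p).
  - by rewrite F0.
  - move=> m n mn; apply/subsetPset => x [Ox rx nx]; split => //.
    by apply: le_trans nx; rewrite ler_nat.
have := cF [set y | (y < e%:E)%E] _.
case=> [|N _ /(_ N (leqnn N)) /= hN].
  by apply: open_nbhs_nbhs; split; [exact: open_ereal_lt_ereal|rewrite /= lte_fin].
exists (N%:R + 1); first by rewrite ltr_wpDl.
exact: (scaled_tail_le p _ _ _ _ mu).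
Qed.

Lemma tail_set_scale {R : realType} {L : nat} (C : set 'rV[R]_L) (k r M : R) x :
  closed_cone C -> 0 < k ->
  tail_set C r M (k^-1 *: x) <-> tail_set C (k * r) (k * M) x.
Proof.
move=> [C0 _ _ coneC] k0; have ik0 : 0 < k^-1 by rewrite invr_gt0.
have Oiff : orthant R L (k^-1 *: x) <-> orthant R L x.
  by split => Ox l; have := Ox l; rewrite mxE pmulr_rge0.
rewrite /tail_set /= dist_toZ// normrZ (gtr0_norm ik0).
by rewrite ![k^-1 * _]mulrC !ler_pdivlMr// ![_ * k]mulrC; split => -[/Oiff].
Qed.

(** If no tail set were charged by the law of [Z], every scaled integral of
    a test function [tail_test] would vanish; so would its limit, hence the
    limit mass of every tail set, and these exhaust the complement of [C]. *)
Lemma tail_positive {R : realType} {L : nat} (p : R) {d : measure_display}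
    {T : measurableType d} (P : probability T R) (Z : T -> 'rV[R]_L)
    (a : R -> R) (C : set 'rV[R]_L)
    (mu : {measure set (borel_rV R L) -> \bar R}) :
  (0 < L)%N -> 1 <= p -> closed_cone C ->
  measurable_fun setT (Z : T -> borel_rV R L) -> (forall t, 0 < t -> 0 < a t) ->
  Mspace p C mu -> mu setT != 0%E -> Mcvg p C (scaled_law P Z a) mu ->
  exists2 r : R, 0 < r & (0 < P [set w | tail_set C r 0 (Z w)])%E.
Proof.
move=> L0 p1 hC mZ a0 [muE _] muT hcvg; have [C0 _ cC _] := hC.
apply: contrapT => noex.
have mE := cone_complement_borel _ cC.
have mts s M : measurable (tail_set C s M : set (borel_rV R L)).
  by apply: closed_borel; exact: tail_set_closed.
have P0 r : 0 < r -> P [set w | tail_set C r 0 (Z w)] = 0%E.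
  move=> r0; apply/eqP; rewrite -[_ == _]negbK -measure_gt0; apply/negP => h.
  by apply: noex; exists r.
have mu0 r : 0 < r -> mu (tail_set C r 0) = 0%E.
  move=> r0; have r20 : 0 < r / 2 by rewrite divr_gt0.
  have ctt := tail_test_continuous C r (-1) C0.
  have tt0 x : 0 <= tail_test C r (-1) x by have /andP[] := tail_test_itv C r (-1) x.
  have mres : measurable_fun setT ((tail_test C r (-1) \_ (orthant R L `\` C))
      : borel_rV R L -> R).
    by apply: restrict_borel => //; exact: continuous_subspaceT.
  have int0 t : 0 < t -> (\int[scaled_law P Z a t]_(x in orthant R L `\` C)
      (tail_test C r (-1) x)%:E = 0)%E.
    move=> t0; rewrite integral_scaled_law//; last exact: continuous_subspaceT.
    rewrite (_ : (\int[P]_w _)%E = 0%E) ?mule0//.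
    apply/eqP; rewrite eq_le integral_ge0 ?andbT; last first.
      by move=> w _; rewrite lee_fin patchE; case: ifPn.
    rewrite -(P0 (a t * (r / 2))) ?mulr_gt0 ?a0//.
    have msc := scale_measurable Z (a t)^-1 mZ.
    apply: integral_le_measure => //.
    - by rewrite -[X in measurable X]setTI; apply: (mZ measurableT).
    - exact: (measurableT_comp mres msc).
    - move=> w _; rewrite patchE; case: ifPn => // _; first exact: tail_test_itv.
      by rewrite lexx ler01.
    - move=> w _; rewrite patchE; case: ifPn => [/set_mem[Ow _]|]; last by rewrite eqxx.
      move=> /(tail_test_neq0 _ _ _ _ r0)[rw _].
      have : tail_set C (r / 2) 0 ((a t)^-1 *: Z w) by split.
      by move=> /(tail_set_scale _ _ _ _ _ hC (a0 _ t0)); rewrite mulr0.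
  have lim0 : (\int[mu]_(x in orthant R L `\` C) (tail_test C r (-1) x)%:E = 0)%E.
    apply: (cvg_unique _ (hcvg _ (tail_test_Mtest p _ r (-1) L0 p1 C0 r0))) => //.
    apply: cvg_near_cst; near=> t; apply: int0.
    by near: t; exact: nbhs_pinfty_gt.
  apply/eqP; rewrite eq_le measure_ge0 andbT -lim0 integral_mkcond.
  rewrite [leRHS](_ : _ = (\int[mu]_x
     ((tail_test C r (-1) \_ (orthant R L `\` C)) x)%:E)%E); last first.
    by apply: eq_integral => x _; rewrite restrict_EFin.
  apply: measure_le_integral => //.
    by move=> w; rewrite patchE; case: ifPn.
  move=> x hx; rewrite patchE mem_set; last exact: tail_set_sub hx.
  by case: hx => Ow rw Mw; rewrite tail_test_eq1// addNr.
move/eqP : muT; apply; apply/eqP; rewrite eq_le measure_ge0 andbT.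
rewrite -(setvU (orthant R L `\` C : set (borel_rV R L))).
apply: le_trans (measureU2 _ _ _) _ => //; first exact: measurableC.
rewrite -[leRHS]adde0; apply: leeD.
  by rewrite le_eqVlt; apply/orP; left; apply/eqP; exact: muE.
(* A point outside the closed set [C] has a positive distance to it. *)
have -> : orthant R L `\` C = \bigcup_n (tail_set C (n.+1%:R^-1) 0).
  apply/seteqP; split => [x [Ox nCx]|x [n _]]; last by apply: tail_set_sub.
  have dx := dist_to_gt0 C x C0 cC nCx.
  exists (Num.bound (dist_to C x)^-1) => //; split => //.
  rewrite -[leRHS]invrK lef_pV2 ?posrE ?invr_gt0//.
  apply: le_trans (ltW (archi_boundP _)) _; first by rewrite invr_ge0 ltW.
  by rewrite ler_nat.
apply: le_trans (measure_sigma_subadditive _ _ _ (@subset_refl _ _)) _ => //.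
  exact: bigcup_measurable.
by rewrite eseries0// => n _ _; exact: mu0.
Unshelve. all: by end_near. Qed.

(** * Growth of scaling functions and decay of tails *)

Lemma pinfty_exists {R : realType} (Q : R -> Prop) :
  (\forall t \near +oo, Q t) -> exists2 T : R, 0 < T & forall t, T <= t -> Q t.
Proof.
move=> [M [_ hM]]; exists (Num.max 0 M + 1).
  by rewrite ltr_wpDl// le_max lexx.
move=> t ht; apply: hM; apply: lt_le_trans ht.
by rewrite ltr_pwDr// le_max lexx orbT.
Qed.

Lemma powR_pinfty {R : realType} (k e A : R) : 0 < k -> 0 < e ->
  \forall t \near +oo, A < k * t `^ e.
Proof.
move=> k0 e0; near=> t.
have tA : (`|A| / k) `^ e^-1 < t by near: t; exact: nbhs_pinfty_gt.
rewrite -ltr_pdivrMl// mulrC.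
apply: le_lt_trans (_ : `|A| / k < _).
  by apply: ler_wpM2r; [rewrite invr_ge0 ltW|exact: ler_norm].
have Ak0 : 0 <= `|A| / k by rewrite divr_ge0// ltW.
rewrite -[X in X < _]powRr1// -[X in _ `^ X](mulVf (lt0r_neq0 e0)) powRrM.
apply: gt0_ltr_powR => //; rewrite ?nnegrE ?powR_ge0//.
Unshelve. all: by end_near. Qed.

Lemma powRN_pinfty {R : realType} (k e eps : R) : 0 < e -> 0 < eps ->
  \forall t \near +oo, k * t `^ (- e) <= eps.
Proof.
move=> e0 eps0; near=> t.
have t0 : 0 < t by near: t; exact: nbhs_pinfty_gt.
have : k < eps * t `^ e by near: t; exact: powR_pinfty.
by rewrite powRN => /ltW; rewrite ler_pdivrMr// powR_gt0.
Unshelve. all: by end_near. Qed.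

(** A single term of the exponential series, of degree [n] with [n e > 2],
    dominates [t ^+ 2]. *)
Lemma expRN_pinfty {R : realType} (k e eps : R) : 0 < k -> 0 < e -> 0 < eps ->
  \forall t \near +oo, t * expR (- (k * t `^ e)) <= eps.
Proof.
move=> k0 e0 eps0.
pose m := Num.bound (2 / e).
have me : 2 < m.+1%:R * e.
  rewrite -ltr_pdivrMr//; apply: lt_trans (archi_boundP _) _.
    by rewrite divr_ge0// ltW.
  by rewrite ltr_nat.
have [K K0 hK] : exists2 K : R, 0 < K & forall x, 0 < x -> expR (- x) <= K / x ^+ m.+1.
  exists (m.+1)`!%:R; first by rewrite ltr0n fact_gt0.
  move=> x x0; rewrite expRN -invf_div lef_pV2 ?posrE ?expR_gt0//; last first.
    by rewrite divr_gt0 ?exprn_gt0// ltr0n fact_gt0.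
  by apply: le_trans (expR_ge1Dxn m (ltW x0)); rewrite lerDr.
near=> t.
have t1 : 1 <= t by near: t; apply: nbhs_pinfty_ge; exact: num_real.
have t0 : 0 < t by exact: lt_le_trans t1.
have kt0 : 0 < k * t `^ e by rewrite mulr_gt0 ?powR_gt0.
apply: le_trans (ler_wpM2l (ltW t0) (hK _ kt0)) _.
apply: le_trans (_ : K / k ^+ m.+1 * t `^ (- 1) <= _); last first.
  by near: t; exact: powRN_pinfty.
have ut : t ^+ 2 <= (t `^ e) ^+ m.+1.
  rewrite -[leLHS]powR_mulrn ?(ltW t0)// -powR_mulrn ?powR_ge0// -powRrM mulrC.
     by apply: ler_powR => //; exact: ltW.
have u0 : 0 < (t `^ e) ^+ m.+1 by rewrite exprn_gt0// powR_gt0.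
rewrite exprMn invfM [leLHS](_ : _ = K / k ^+ m.+1 * (t / (t `^ e) ^+ m.+1)); last by ring.
rewrite ler_pM2l ?divr_gt0 ?exprn_gt0// powR_inv1 ?(ltW t0)// ler_pdivrMr//.
by rewrite ler_pdivlMl// -expr2.
Unshelve. all: by end_near. Qed.

(** The ratio [b (2 t) / b t] eventually exceeds [2 ^ eta], so the bound
    propagates from each interval to its double. The lower bound [y] starts
    the induction on [T, 2 T], where pointwise regular variation gives
    no uniform control. *)
Lemma regularly_varying_ge_powR {R : realType} (b : R -> R) (rho eta y : R) :
  regularly_varying rho b -> 0 <= eta -> eta < rho -> 0 < y ->
  (\forall t \near +oo, y <= b t) ->
  exists2 k, 0 < k & \forall t \near +oo, k * t `^ eta <= b t.
Proof.
move=> [b0 hb] eta0 etarho y0 hy.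
have : \forall t \near +oo, 2 `^ eta < b (t * 2) / b t.
  apply: (cvgr_gt _ (hb 2 _)) => //.
  by rewrite /powR pnatr_eq0/= ltr_expR ltr_pM2r// ln_gt0// ltr1n.
move=> /filterI /(_ hy) /pinfty_exists[T T0 hT].
have T20 : 0 < T * 2 by rewrite mulr_gt0.
exists (y / (T * 2) `^ eta); first by rewrite divr_gt0// powR_gt0.
have claim n t : T <= t -> t <= T * 2 ^+ n.+1 -> y / (T * 2) `^ eta * t `^ eta <= b t.
  elim: n t => [|n IH] t Tt tT.
    apply: le_trans (hT _ Tt).2.
    rewrite mulrAC ler_pdivrMr ?powR_gt0// ler_pM2l//.
    apply: ge0_ler_powR; rewrite ?nnegrE ?(ltW T20)//.
    exact: ltW (lt_le_trans T0 Tt).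
  have t0 := lt_le_trans T0 Tt.
  case: (lerP t (T * 2)) => t2T.
    apply: le_trans (hT _ Tt).2.
    rewrite mulrAC ler_pdivrMr ?powR_gt0// ler_pM2l//.
    by apply: ge0_ler_powR; rewrite ?nnegrE ?(ltW T20) ?(ltW t0).
  have Tt2 : T <= t / 2 by rewrite ler_pdivlMr// ltW.
  have tt2 : t / 2 <= T * 2 ^+ n.+1 by rewrite ler_pdivrMr// -mulrA -exprSr.
  have := (hT _ Tt2).1; rewrite divfK// ltr_pdivlMr ?b0 ?divr_gt0// => /ltW.
  apply: le_trans.
  apply: le_trans (ler_wpM2l (powR_ge0 _ _) (IH _ Tt2 tt2)).
  by rewrite mulrCA -powRM ?divr_ge0 ?(ltW t0)// [2 * _]mulrC divfK.
near=> t.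
have Tt : T <= t by near: t; apply: nbhs_pinfty_ge; exact: num_real.
apply: (claim (Num.bound (t / T))) => //.
have t0 := lt_le_trans T0 Tt.
rewrite mulrC -ler_pdivrMr//; apply: le_trans (ltW (archi_boundP _)) _.
  by rewrite divr_ge0// ltW.
by rewrite -natrX ler_nat; apply/ltnW/(ltn_trans (ltnSn _)); exact: ltn_expl.
Unshelve. all: by end_near. Qed.

(** Only the values of [b] at [T, 2 T, 4 T, ...] enter: they grow at most like
    powers of [2 ^ (1 / beta)], and [G], being nonincreasing, is controlled
    between two consecutive ones. *)
Lemma tail_le_powR {R : realType} (b G : R -> R) (rho beta K : R) :
  regularly_varying rho b -> 0 < beta -> rho * beta < 1 ->
  (forall x y, x <= y -> G y <= G x) -> (forall x, 0 <= G x) ->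
  (\forall t \near +oo, t * G (b t) <= K) ->
  exists2 k, 0 <= k & \forall y \near +oo, G y <= k * y `^ (- beta).
Proof.
move=> [b0 hb] beta0 rb Gmono G0 hG.
have : \forall t \near +oo, b (t * 2) / b t < 2 `^ beta^-1.
  apply: (cvgr_lt _ (hb 2 _)) => //.
  rewrite /powR pnatr_eq0/= ltr_expR ltr_pM2r; last by rewrite ln_gt0// ltr1n.
  by rewrite -[ltRHS]mul1r ltr_pdivlMr.
move=> /filterI /(_ hG) /pinfty_exists[T T0 hT].
pose B := b T; have B0 : 0 < B by exact: b0.
have K0 : 0 <= K by apply: le_trans (hT _ (lexx T)).2; rewrite mulr_ge0// ltW.
have T2n n : T <= T * 2 ^+ n by rewrite ler_peMr ?(ltW T0)// exprn_ege1// ler1n.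
have bn n : b (T * 2 ^+ n) <= B * (2 ^+ n) `^ beta^-1.
  elim: n => [|n IH]; first by rewrite expr0 !mulr1 powR1 mulr1.
  have /ltW := (hT _ (T2n n)).1.
  rewrite ler_pdivrMr ?b0 ?mulr_gt0 ?exprn_gt0// -mulrA -exprSr => /le_trans; apply.
  rewrite exprSr powRM ?exprn_ge0// mulrA mulrC.
  by rewrite ler_pM2r ?powR_gt0.
pose k := K / T * 2 * B `^ beta.
have k0 : 0 <= k by rewrite !mulr_ge0 ?invr_ge0 ?powR_ge0// ltW.
have step n y : 0 < y -> B * (2 ^+ n) `^ beta^-1 <= y ->
    y <= B * (2 ^+ n.+1) `^ beta^-1 -> G y <= k * y `^ (- beta).
  move=> y0 yge yle.
  have Gy : G y <= K / (T * 2 ^+ n).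
    rewrite ler_pdivlMr ?mulr_gt0 ?exprn_gt0// mulrC.
    apply: le_trans (hT _ (T2n n)).2.
    by rewrite ler_pM2l ?mulr_gt0 ?exprn_gt0//; apply/Gmono/(le_trans (bn n)).
  apply: le_trans Gy _; rewrite powRN ler_pdivlMr ?powR_gt0//.
  have yb : y `^ beta <= B `^ beta * 2 ^+ n.+1.
    apply: le_trans (_ : (B * (2 ^+ n.+1) `^ beta^-1) `^ beta <= _).
      by apply: ge0_ler_powR; rewrite ?nnegrE ?(ltW beta0) ?(ltW y0)// (le_trans _ yle)// ltW.
    by rewrite powRM ?powR_ge0 ?(ltW B0)// -powRrM mulVf ?lt0r_neq0// powRr1// exprn_ge0.
  apply: le_trans (ler_wpM2l _ yb) _.
    by rewrite divr_ge0// mulr_ge0 ?exprn_ge0// ltW.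
  rewrite /k exprS le_eqVlt; apply/orP; left; apply/eqP; field.
  by rewrite expf_neq0 ?pnatr_eq0//= lt0r_neq0.
have claim n y : B <= y -> y <= B * (2 ^+ n.+1) `^ beta^-1 -> G y <= k * y `^ (- beta).
  elim: n y => [|n IH] y By yle; have y0 := lt_le_trans B0 By.
    by apply: (step 0%N) => //; rewrite expr0 powR1 mulr1.
  case: (lerP y (B * (2 ^+ n.+1) `^ beta^-1)) => [|/ltW] h; first exact: IH.
  exact: (step n.+1).
exists k => //; near=> y.
have By : B <= y by near: y; apply: nbhs_pinfty_ge; exact: num_real.
have y0 := lt_le_trans B0 By.
apply: (claim (Num.bound ((y / B) `^ beta))) => //.
rewrite mulrC -ler_pdivrMr//.
have yB0 : 0 <= y / B by rewrite divr_ge0// ltW.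
rewrite [leLHS](_ : _ = ((y / B) `^ beta) `^ beta^-1); last first.
  by rewrite -powRrM divff ?lt0r_neq0// powRr1.
apply: ge0_ler_powR; rewrite ?nnegrE ?powR_ge0 ?exprn_ge0 ?invr_ge0 ?(ltW beta0)//.
apply: le_trans (ltW (archi_boundP (powR_ge0 _ _))) _.
by rewrite -natrX ler_nat; apply/ltnW/(ltn_trans (ltnSn _)); exact: ltn_expl.
Unshelve. all: by end_near. Qed.

(** The bound obtained is of order [t ^ (1 - eta s beta)]. *)
Lemma scaled_tail_powR_small {R : realType} (b G : R -> R)
    (k eta s beta k' eps : R) :
  0 < k -> 0 < eta -> 0 < s -> 0 < beta -> 1 < eta * s * beta -> 0 < eps ->
  (\forall t \near +oo, k * t `^ eta <= b t) ->
  (\forall y \near +oo, G y <= k' * y `^ (- beta)) ->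
  (forall x y, x <= y -> G y <= G x) ->
  \forall t \near +oo, t * G (b t `^ s) <= eps.
Proof.
move=> k0 eta0 s0 beta0 gt1 eps0 hb /pinfty_exists[Y Y0 hG] Gmono.
near=> t.
have t0 : 0 < t by near: t; exact: nbhs_pinfty_gt.
have kb : k * t `^ eta <= b t by near: t.
have kt0 : 0 < k * t `^ eta by rewrite mulr_gt0// powR_gt0.
have E : (k * t `^ eta) `^ s = k `^ s * t `^ (eta * s).
  by rewrite powRM ?powR_ge0 ?(ltW k0)// -powRrM.
have YE : Y <= k `^ s * t `^ (eta * s).
  by apply: ltW; near: t; apply: powR_pinfty; rewrite ?powR_gt0 ?mulr_gt0.
have le1 : G (b t `^ s) <= k' * (k `^ s * t `^ (eta * s)) `^ (- beta).
  apply: le_trans (hG _ YE); apply: Gmono; rewrite -E.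
  by apply: ge0_ler_powR; rewrite ?nnegrE ?(ltW s0) ?(ltW kt0)// (le_trans (ltW kt0)).
apply: le_trans (ler_wpM2l (ltW t0) le1) _.
have tE : t `^ (- (eta * s * beta - 1)) = t * t `^ (- (eta * s * beta)).
  by rewrite opprB powRD ?(lt0r_neq0 t0) ?implybT// powRr1// ltW.
rewrite powRM ?powR_ge0// -(powRrM t) mulrN.
rewrite [leLHS](_ : _ = k' * (k `^ s) `^ (- beta) * t `^ (- (eta * s * beta - 1))); last first.
  by rewrite tE; ring.
by near: t; apply: powRN_pinfty; rewrite ?subr_gt0.
Unshelve. all: by end_near. Qed.

Lemma scaled_expR_powR_small {R : realType} (b : R -> R) (k eta kappa K r eps : R) :
  0 < k -> 0 < eta -> 0 < kappa -> 0 < K -> 0 < r -> 0 < eps ->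
  (\forall t \near +oo, k * t `^ eta <= b t) ->
  \forall t \near +oo, t * (K * expR (- (r * b t `^ kappa))) <= eps.
Proof.
move=> k0 eta0 kappa0 K0 r0 eps0 hb; near=> t.
have t0 : 0 < t by near: t; exact: nbhs_pinfty_gt.
have kb : k * t `^ eta <= b t by near: t.
have kt0 : 0 < k * t `^ eta by rewrite mulr_gt0// powR_gt0.
have le1 : (k `^ kappa) * t `^ (eta * kappa) <= b t `^ kappa.
  rewrite powRrM -powRM ?powR_ge0 ?(ltW k0)//.
  by apply: ge0_ler_powR; rewrite ?nnegrE ?(ltW kappa0) ?(ltW kt0)// (le_trans (ltW kt0)).
rewrite mulrCA mulrC -ler_pdivlMr//.
apply: le_trans (_ : t * expR (- (r * k `^ kappa * t `^ (eta * kappa))) <= _).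
  by rewrite ler_pM2l// ler_expR lerN2 -mulrA ler_pM2l.
by near: t; apply: expRN_pinfty; [rewrite mulr_gt0 ?powR_gt0|exact: mulr_gt0|exact: divr_gt0].
Unshelve. all: by end_near. Qed.

(** * Concentration of Poisson vectors *)

(** Taking inverses in [1 - x <= expR (- x)]; the bound on [|x|] keeps [1 - x]
    positive and gives [1 / (1 - x) <= 1 + x + 2 x ^ 2]. *)
Lemma expR_le_quadratic {R : realType} (x : R) :
  `|x| <= 1 / 2 -> expR x <= 1 + x + 2 * x ^+ 2.
Proof.
rewrite ler_norml => /andP[xge xle].
have x1 : 0 < 1 - x by lra.
have : 1 - x <= expR (- x) by exact: expR_ge1Dx.
rewrite expRN -[X in X <= _ -> _]invrK lef_pV2 ?posrE ?invr_gt0 ?expR_gt0//.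
move=> /le_trans; apply; rewrite -[leLHS]mul1r ler_pdivrMr//.
have x2 : 0 <= x ^+ 2 * (1 - 2 * x) by rewrite mulr_ge0 ?sqr_ge0//; lra.
by rewrite -subr_ge0 (_ : _ - 1 = x ^+ 2 * (1 - 2 * x))//; ring.
Qed.

Lemma nneseries_expR {R : realType} (x : R) : 0 <= x ->
  (\sum_(0 <= k <oo) (x ^+ k / k`!%:R)%:E = (expR x)%:E)%E.
Proof.
move=> x0; rewrite expRE -EFin_lim; last first.
  rewrite /pseries/=; under eq_fun do rewrite mulrC.
  exact: is_cvg_series_exp_coeff.
apply/congr_lim/funext => n/=; rewrite /pseries/= /series/= -sumEFin//.
by under eq_bigr do rewrite mulrC.
Qed.

(** With [0 ^+ 0 = 1] the usual formula also describes the point mass at [0]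
    when [r = 0], so that a vanishing intensity is not a separate case. *)
Definition poisson_weight {R : realType} (r : R) (k : nat) : R :=
  r ^+ k / k`!%:R * expR (- r).

Lemma poisson_law_point {R : realType} (r : R) (k : nat) : 0 <= r ->
  poisson_law r [set k%:R] = (poisson_weight r k)%:E.
Proof.
move=> r0; rewrite /poisson_law.
have -> : [set j : nat | [set k%:R] (j%:R : R)] = [set k].
  apply/seteqP; split => j /=; last by move=> ->.
  by move/eqP; rewrite eqr_nat => /eqP.
rewrite /poisson_prob /poisson_weight; case: ltgtP r0 => // [r0|<-] _.
  by rewrite esum_set1 /poisson_pmf ?r0// lee_fin mulr_ge0 ?expR_ge0 ?divr_ge0 ?exprn_ge0 ?ltW.
rewrite oppr0 expR0 mulr1 diracE; case: k => [|k].
  by rewrite expr0 fact0 divr1 mem_set.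
by rewrite expr0n mul0r memNset.
Qed.

Lemma poisson_law_setT {R : realType} (r : R) : poisson_law r setT = 1%E.
Proof.
by rewrite /poisson_law (_ : [set k : nat | _] = setT) ?probability_setT.
Qed.

Lemma poisson_law_notnat {R : realType} (r : R) :
  poisson_law r (~` range (fun k : nat => k%:R)) = 0%E.
Proof.
rewrite /poisson_law (_ : [set k : nat | _] = set0) ?measure0//.
by apply/seteqP; split => // k /= [] ; exists k.
Qed.

Lemma poisson_mgf {R : realType} (r x : R) : 0 <= r ->
  (\sum_(0 <= k <oo) (poisson_weight r k * expR (x * k%:R))%:E =
   (expR (r * (expR x - 1)))%:E)%E.
Proof.
move=> r0; rewrite mulrBr mulr1 addrC expRD EFinM -(nneseries_expR (r * expR x)); last first.
  by rewrite mulr_ge0// expR_ge0.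
rewrite -nneseriesZl; last first.
  by move=> k _; rewrite lee_fin divr_ge0// exprn_ge0// mulr_ge0// expR_ge0.
apply: eq_eseriesr => k _; rewrite -EFinM /poisson_weight exprMn -expRM_natr.
by congr (_%:E); ring.
Qed.

(** The conditional law of one entry: take the whole line for the other sides of
    the rectangle. *)
Lemma poisson_marginal {R : realType} {L : nat} {d : measure_display}
    {T : measurableType d} (P : probability T R) (c : 'I_L -> R)
    (X Y : T -> 'rV[R]_L) (l : 'I_L) (A : set R) (B : set (borel_rV R L)) :
  cond_indep_poisson P c X Y -> measurable A -> measurable B ->
  P ([set w | A (Y w 0 l)] `&` X @^-1` B) =
  (\int[P]_(w in X @^-1` B) poisson_law (c l * X w 0 l)%R A)%E.
Proof.
move=> hY mA mB; pose F l' := if l' == l then A else setT.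
have mF l' : measurable (F l') by rewrite /F; case: ifP.
have [_ /(_ B mB)] := hY F mF.
have -> : [set w | forall l', F l' (Y w 0 l')] = [set w | A (Y w 0 l)].
  apply/seteqP; split => w /=; first by move/(_ l); rewrite /F eqxx.
  by move=> Aw l'; rewrite /F; case: eqP => [->|].
move=> ->; apply: eq_integral => w _.
rewrite (bigD1 l)//= /F eqxx big1 ?mule1// => l' /negbTE ->.
exact: poisson_law_setT.
Qed.

Lemma poisson_entries_natural {R : realType} {L : nat} {d : measure_display}
    {T : measurableType d} (P : probability T R) (c : 'I_L -> R)
    (X Y : T -> 'rV[R]_L) (l : 'I_L) :
  cond_indep_poisson P c X Y ->
  P [set w | ~ exists k : nat, Y w 0 l = k%:R] = 0%E.
Proof.
move=> hY; pose A : set R := ~` range (fun k : nat => k%:R).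
have mA : measurable A.
  apply: measurableC; apply: countable_measurable; first exact: measurable_set1.
  by apply: (sub_countable (card_image_le _ _)); exact: countableP.
have := poisson_marginal P c X Y l A setT hY mA measurableT.
rewrite setIT preimage_setT => /= e.
rewrite (_ : [set w | _] = [set w | A (Y w 0 l)]).
  by rewrite e integral0_eq// => w _; exact: poisson_law_notnat.
by apply/seteqP; split => w /= h [k]; [move=> _ kY|move=> kY]; apply: h; exists k.
Qed.

Lemma coord_borel {R : realType} {L : nat} (l : 'I_L) :
  measurable_fun setT ((fun x : 'rV[R]_L => x 0 l) : borel_rV R L -> R).
Proof. by apply: continuous_borel => x; exact: coord_continuous. Qed.

(** The event involves [X] and [Y] together, whereas the conditional law is
    given on rectangles. Cutting it along the countably many values [k] of
    [Y w 0 l] turns it into a union of sets of the form [Y w 0 l = k] and [X w]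
    in [B k]. On each of them the exponential weight
    [expR (x (k - c l X_l) - v)] is at least [1], and summed over all [k] with the
    Poisson masses these weights give the Poisson moment generating function, whose exponent
    [c l X_l (expR x - 1 - x) - v] is at most [2 u x ^ 2 - v]. *)
Lemma poisson_chernoff {R : realType} {L : nat} {d : measure_display}
    {T : measurableType d} (P : probability T R) (c : 'I_L -> R)
    (X Y : T -> 'rV[R]_L) (l : 'I_L) (x u v : R) :
  cond_indep_poisson P c X Y ->
  measurable_fun setT (X : T -> borel_rV R L) ->
  measurable_fun setT (Y : T -> borel_rV R L) ->
  (forall w, 0 <= c l * X w 0 l) -> `|x| <= 1 / 2 ->
  (P [set w | [/\ exists k : nat, Y w 0 l = k%:R, c l * X w 0 l <= u &
                  v <= x * (Y w 0 l - c l * X w 0 l)]%R]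
   <= (expR (2 * u * x ^+ 2 - v))%:E)%E.
Proof.
move=> hY mX mY X0 hx.
pose lam w := c l * X w 0 l.
have mXl : measurable_fun setT (fun w => X w 0 l).
  exact: (measurableT_comp (coord_borel l) mX).
have mYl : measurable_fun setT (fun w => Y w 0 l).
  exact: (measurableT_comp (coord_borel l) mY).
have mlam : measurable_fun setT lam by exact: measurable_funM.
pose B (k : nat) : set (borel_rV R L) :=
  [set y | c l * y 0 l <= u /\ v <= x * (k%:R - c l * y 0 l)].
have mcl : measurable_fun setT ((fun y => c l * y 0 l) : borel_rV R L -> R).
  by apply: measurable_funM => //; exact: coord_borel.
have mB k : measurable (B k).
  have mle : measurable_fun setT (fun y : borel_rV R L => x * (k%:R - c l * (y : 'rV[R]_L) 0 l)).
    by apply: measurable_funM => //; exact: measurable_funB.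
  have -> : B k = ((fun y : borel_rV R L => c l * (y : 'rV[R]_L) 0 l) @^-1` [set z | z <= u]) `&`
     ((fun y : borel_rV R L => x * (k%:R - c l * (y : 'rV[R]_L) 0 l)) @^-1` [set z | v <= z]) by [].
  apply: measurableI; rewrite -[X in measurable X]setTI.
    by apply: mcl => //; apply: closed_measurable; exact: closed_le.
  by apply: mle => //; apply: closed_measurable; exact: closed_ge.
pose S : set T := [set w | lam w <= u].
have mS : measurable S.
  rewrite -[X in measurable X]setTI; apply: (mlam measurableT [set z | z <= u]).
  by apply: closed_measurable; exact: closed_le.
pose F k w := poisson_weight (lam w) k * expR (x * (k%:R - lam w) - v).
have F0 k w : 0 <= F k w.
  by rewrite /F /poisson_weight !mulr_ge0 ?expR_ge0 ?invr_ge0 ?exprn_ge0// X0.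
have mq k : measurable_fun setT (fun w => poisson_weight (lam w) k).
  apply: measurable_funM; first by apply: measurable_funM => //; exact: measurable_funX.
  by apply: measurableT_comp => //; exact: measurableT_comp.
have mF k : measurable_fun setT (F k).
  apply: measurable_funM; first exact: mq.
  apply: measurableT_comp => //; apply: measurable_funB => //.
  by apply: measurable_funM => //; exact: measurable_funB.
have cell k : (P ([set w | [set k%:R] (Y w 0%R l)] `&` X @^-1` B k) <=
    \int[P]_(w in S) (F k w)%:E)%E.
  rewrite (poisson_marginal P c)//.
  have mXB : measurable (X @^-1` B k).
    by rewrite -[X in measurable X]setTI; exact: mX.
  have q0 w : 0 <= poisson_weight (lam w) k.
    by rewrite /poisson_weight !mulr_ge0 ?expR_ge0 ?invr_ge0 ?exprn_ge0// X0.
  apply: le_trans (_ : \int[P]_(w in X @^-1` B k) (F k w)%:E <= _)%E; last first.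
    apply: ge0_subset_integral => //.
    - by apply/measurable_EFinP; exact: measurable_funTS.
    - by move=> w _; rewrite lee_fin.
    - by move=> w [].
  rewrite (eq_integral (fun w => (poisson_weight (lam w) k)%:E)); last first.
    by move=> w _; rewrite poisson_law_point// X0.
  apply: ge0_le_integral => //.
  - by move=> w _; rewrite lee_fin.
  - by apply/measurable_EFinP; exact: measurable_funTS.
  - by apply/measurable_EFinP; exact: measurable_funTS.
  - move=> w [wu vw]; rewrite lee_fin /F ler_peMr//.
    by rewrite -[leLHS]expR0 ler_expR subr_ge0.
have mpoint k : measurable [set w | [set k%:R] (Y w 0 l)].
  by rewrite -[X in measurable X]setTI; exact: (mYl measurableT [set k%:R] (measurable_set1 _)).
have mcell k : measurable ([set w | [set k%:R] (Y w 0 l)] `&` X @^-1` B k).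
  apply: measurableI => //.
  by rewrite -[X in measurable X]setTI; exact: mX.
have mE : measurable [set w | [/\ exists k : nat, Y w 0 l = k%:R,
    c l * X w 0 l <= u & v <= x * (Y w 0 l - c l * X w 0 l)]].
  rewrite (_ : mkset _ =
      \bigcup_k ([set w | [set k%:R] (Y w 0 l)] `&` X @^-1` B k)).
    exact: bigcup_measurable.
  apply/seteqP; split => [w [[k kY] wu vw]|w [k _ [/= kY [wu vw]]]].
    by exists k => //; split => //; split => //=; rewrite -kY.
  by split => //; [exists k|rewrite kY].
apply: le_trans (_ : \sum_(0 <= k <oo) \int[P]_(w in S) (F k w)%:E <= _)%E.
  apply: le_trans (lee_nneseries _ (fun k _ => cell k)); last by [].
  apply: measure_sigma_subadditive => // w /= [[k kY] wu vw].
  by exists k => //; split => //; split => //=; rewrite -kY.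
rewrite -integral_nneseries//; last 2 first.
- by move=> k; apply/measurable_EFinP; exact: measurable_funTS.
- by move=> k w _; rewrite lee_fin.
have sumF w : (\sum_(0 <= k <oo) (F k w)%:E =
    (expR (lam w * (expR x - 1 - x) - v))%:E)%E.
  rewrite (_ : (expR _)%:E = ((expR (- (x * lam w) - v))%:E *
      (expR (lam w * (expR x - 1)))%:E)%E); last first.
    by rewrite -EFinM -expRD; congr ((expR _)%:E); ring.
  rewrite -poisson_mgf ?X0// -nneseriesZl; last first.
    move=> k _; rewrite lee_fin /poisson_weight.
    by rewrite !mulr_ge0 ?expR_ge0 ?invr_ge0 ?exprn_ge0// X0.
  apply: eq_eseriesr => k _; rewrite -EFinM mulrCA -expRD /F.
  by congr ((_ * expR _)%:E); ring.
under eq_integral do rewrite sumF.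
apply: le_trans (_ : \int[P]_(w in S) (expR (2 * u * x ^+ 2 - v))%:E <= _)%E.
  apply: ge0_le_integral => //.
  - apply/measurable_EFinP; apply: measurable_funTS; apply: measurableT_comp => //.
    by apply: measurable_funB => //; exact: measurable_funM.
  - move=> w wu; rewrite lee_fin ler_expR lerD2r.
    have ex := expR_le_quadratic x hx.
    apply: le_trans (_ : lam w * (2 * x ^+ 2) <= _).
      by apply: ler_wpM2l; [exact: X0|lra].
    rewrite (_ : 2 * u * x ^+ 2 = u * (2 * x ^+ 2)); last by ring.
    by apply: ler_wpM2r => //; rewrite mulr_ge0// sqr_ge0.
rewrite integral_cst// -[leRHS]mule1; apply: lee_wpmul2l.
  by rewrite lee_fin expR_ge0.
exact: probability_le1.
Qed.

Lemma measure_exists_le {d : measure_display} {T : measurableType d}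
    {R : realType} (mu : {measure set T -> \bar R}) (L : nat) (A : 'I_L -> set T) :
  (forall l, measurable (A l)) ->
  measurable [set w | exists l, A l w] /\
  (mu [set w | exists l, A l w] <= \sum_(l < L) mu (A l))%E.
Proof.
move=> mA.
have -> : [set w | exists l, A l w] = \big[setU/set0]_(l < L) A l.
  rewrite -bigcup_seq; apply/seteqP; split => w [l]; last by exists l.
  by exists l => //=; exact: mem_index_enum.
apply: (big_ind2 (fun X m => measurable X /\ (mu X <= m)%E)).
- by rewrite measure0.
- move=> X m Y n [mX hX] [mY hY]; split; first exact: measurableU.
  exact: le_trans (measureU2 _ mX mY) (leeD hX hY).
- by move=> l _.
Qed.

(** The exceptional event of coordinate [l]. The first alternative has
    probability zero; excluding it makes the entry a natural number, in
    particular nonnegative. *)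
Definition poisson_bad {R : realType} {L : nat} {T : Type} (c : 'I_L -> R)
    (X Y : T -> 'rV[R]_L) (u z : R) (l : 'I_L) : set T :=
  [set w | [\/ ~ exists k : nat, Y w 0 l = k%:R, u < c l * X w 0 l |
               z <= `|Y w 0 l - c l * X w 0 l|]].

Lemma natural_entry_measurable {R : realType} {L : nat} {d : measure_display}
    {T : measurableType d} (Y : T -> 'rV[R]_L) (l : 'I_L) :
  measurable_fun setT (Y : T -> borel_rV R L) ->
  measurable [set w | exists k : nat, Y w 0 l = k%:R].
Proof.
move=> mY; have mYl : measurable_fun setT (fun w => Y w 0 l).
  exact: (measurableT_comp (coord_borel l) mY).
rewrite (_ : mkset _ = \bigcup_(k : nat) [set w | Y w 0 l = k%:R]).
  apply: bigcup_measurable => k _; rewrite -[X in measurable X]setTI.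
  exact: (mYl measurableT [set k%:R] (measurable_set1 _)).
by apply/seteqP; split => w [k]; exists k.
Qed.

Lemma level_measurable {d : measure_display} {T : measurableType d} {R : realType}
    (f : T -> R) (u : R) : measurable_fun setT f ->
  measurable [set w | f w <= u] /\ measurable [set w | u <= f w].
Proof.
move=> mf; split; rewrite -[X in measurable X]setTI.
  apply: (mf measurableT [set z | z <= u]).
  by apply: closed_measurable; exact: closed_le.
apply: (mf measurableT [set z | u <= z]).
by apply: closed_measurable; exact: closed_ge.
Qed.

Lemma poisson_bad_measurable {R : realType} {L : nat} {d : measure_display}
    {T : measurableType d} (c : 'I_L -> R) (X Y : T -> 'rV[R]_L) (u z : R) (l : 'I_L) :
  measurable_fun setT (X : T -> borel_rV R L) ->
  measurable_fun setT (Y : T -> borel_rV R L) ->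
  measurable (poisson_bad c X Y u z l).
Proof.
move=> mX mY.
have mXl : measurable_fun setT (fun w => X w 0 l).
  exact: (measurableT_comp (coord_borel l) mX).
have mYl : measurable_fun setT (fun w => Y w 0 l).
  exact: (measurableT_comp (coord_borel l) mY).
have mlam : measurable_fun setT (fun w => c l * X w 0 l) by exact: measurable_funM.
have mdiff : measurable_fun setT (fun w => Y w 0 l - c l * X w 0 l).
  exact: measurable_funB.
have mnat := natural_entry_measurable Y l mY.
have mle := (level_measurable _ u mlam).1.
rewrite (_ : poisson_bad _ _ _ _ _ _ = ~` [set w | exists k : nat, Y w 0 l = k%:R] `|`
   (~` [set w | c l * X w 0 l <= u] `|`
    [set w | z <= `|Y w 0 l - c l * X w 0 l|])).
  apply: measurableU; first exact: measurableC.
  apply: measurableU; first exact: measurableC.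
  by apply: (level_measurable _ _ _).2; exact: measurableT_comp.
apply/seteqP; split => w.
  move=> [h|h|h]; [by left|right; left|by right; right].
  by apply/negP; rewrite -ltNge.
move=> [h|[h|h]]; [by apply: Or31|apply: Or32|by apply: Or33].
by rewrite ltNge; apply/negP.
Qed.

(** Chernoff's bound at [x] and [- x] controls the deviations of both signs. *)
Lemma poisson_bad_le {R : realType} {L : nat} {d : measure_display}
    {T : measurableType d} (P : probability T R) (c : 'I_L -> R)
    (X Y : T -> 'rV[R]_L) (u z x : R) (l : 'I_L) :
  cond_indep_poisson P c X Y ->
  measurable_fun setT (X : T -> borel_rV R L) ->
  measurable_fun setT (Y : T -> borel_rV R L) ->
  (forall w, 0 <= c l * X w 0 l) -> 0 <= x <= 1 / 2 ->
  (P (poisson_bad c X Y u z l) <=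
     P [set w | u <= c l * X w 0 l]%R + (2 * expR (2 * u * x ^+ 2 - x * z))%:E)%E.
Proof.
move=> hY mX mY X0 /andP[x0 x1].
have mXl : measurable_fun setT (fun w => X w 0 l).
  exact: (measurableT_comp (coord_borel l) mX).
have mYl : measurable_fun setT (fun w => Y w 0 l).
  exact: (measurableT_comp (coord_borel l) mY).
have mlam : measurable_fun setT (fun w => c l * X w 0 l) by exact: measurable_funM.
have mdiff : measurable_fun setT (fun w => Y w 0 l - c l * X w 0 l).
  exact: measurable_funB.
have mnat := natural_entry_measurable Y l mY.
have [mle mge] := level_measurable _ u mlam.
pose chern (y : R) := [set w | [/\ exists k : nat, Y w 0 l = k%:R,
   c l * X w 0 l <= u & x * z <= y * (Y w 0 l - c l * X w 0 l)]].
have mchern y : measurable (chern y).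
  have myd : measurable_fun setT (fun w => y * (Y w 0 l - c l * X w 0 l)).
    exact: measurable_funM.
  rewrite (_ : chern y = [set w | exists k : nat, Y w 0 l = k%:R] `&`
     ([set w | c l * X w 0 l <= u] `&`
      [set w | x * z <= y * (Y w 0 l - c l * X w 0 l)])).
    by do 2![apply: measurableI => //]; exact: (level_measurable _ _ myd).2.
  by apply/seteqP; split => w; [case|case=> ? []].
have mbad := poisson_bad_measurable c X Y u z l mX mY.
pose nonnat := [set w | ~ exists k : nat, Y w 0 l = k%:R].
have mnn : measurable nonnat by exact: measurableC.
pose high := [set w | u <= c l * X w 0 l].
have incl : (P (poisson_bad c X Y u z l) <=
    P (nonnat `|` (high `|` (chern x `|` chern (- x)%R))))%E.
  apply: le_measure; rewrite ?inE//.
    by do 3![apply: measurableU => //].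
  move=> w bw; have [hk|] := pselect (exists k : nat, Y w 0 l = k%:R); last by left.
  have [hu|hu] := lerP (c l * X w 0 l) u; last by right; left; exact: ltW.
  right; right; case: bw => [//|| hz]; first by rewrite ltNge hu.
  have [d0|d0] := lerP 0 (Y w 0 l - c l * X w 0 l).
    by left; split => //; apply: ler_wpM2l => //; rewrite -(ger0_norm d0).
  right; split => //; rewrite mulNr -mulrN; apply: ler_wpM2l => //.
  by rewrite -(ltr0_norm d0).
apply: (le_trans incl); apply: le_trans (measureU2 _ _ _) _ => //.
  by do 2![apply: measurableU => //].
have nn0 : (P nonnat <= 0)%E.
  by rewrite /nonnat (poisson_entries_natural P c X Y l hY).
rewrite -[leRHS]add0e; apply: (leeD nn0).
apply: le_trans (measureU2 _ _ _) _ => //; first exact: measurableU.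
apply: leeD => //; apply: le_trans (measureU2 _ _ _) _ => //.
rewrite mulr_natl mulr2n EFinD; apply: leeD.
  by apply: poisson_chernoff => //; rewrite ger0_norm.
rewrite -[x in (x ^+ 2)%R]opprK sqrrN; apply: poisson_chernoff => //.
by rewrite normrN ger0_norm.
Qed.

(** * Deviations from the conditional mean at the scale of the second limit *)

(** By [regularly_varying_ge_powR] it suffices to bound [a] below by a positive
    constant. If [a t < r], the tail event of [Z] at level [r] is contained in
    the one at level [a t], whose probability is [O(1/t)]; for large [t] this
    contradicts the positive probability found in [tail_positive]. *)
Lemma MRV_scaling_ge_powR {R : realType} {L : nat} (p : R) {d : measure_display}
    {T : measurableType d} (P : probability T R) (Z : T -> 'rV[R]_L)
    (gamma : R) (a : R -> R) (mu : {measure set (borel_rV R L) -> \bar R})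
    (C : set 'rV[R]_L) (eta : R) :
  (0 < L)%N -> 1 <= p -> closed_cone C ->
  measurable_fun setT (Z : T -> borel_rV R L) ->
  MRV p P Z gamma a mu C -> 0 <= eta -> eta < gamma^-1 ->
  exists2 k, 0 < k & \forall t \near +oo, k * t `^ eta <= a t.
Proof.
move=> L0 p1 hC mZ [gamma0 rv hmu muT hcvg] eta0 etag.
have [C0 _ cC _] := hC; have [a0 _] := rv.
have [r r0 Pr] := tail_positive p P Z a C mu L0 p1 hC mZ a0 hmu muT hcvg.
have [K hK] := scaled_tail_bounded p P Z a C mu 1 L0 p1 C0 cC ltr01 mZ hmu hcvg.
have mts s : measurable [set w | tail_set C s 0 (Z w)].
  rewrite -[X in measurable X]setTI; apply: (mZ measurableT).
  by apply: closed_borel; exact: tail_set_closed.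
apply: (regularly_varying_ge_powR _ _ _ _ rv eta0 etag r0).
near=> t; rewrite leNgt; apply/negP => atr.
have t0 : 0 < t by near: t; exact: nbhs_pinfty_gt.
have : (t%:E * P [set w | tail_set C 1 0 ((a t)^-1 *: Z w)] <= K%:E)%E by near: t.
have -> : [set w | tail_set C 1 0 ((a t)^-1 *: Z w)] = [set w | tail_set C (a t) 0 (Z w)].
  apply/seteqP; split => w /=.
    by move/(tail_set_scale _ _ _ _ _ hC (a0 _ t0)); rewrite mulr1 mulr0.
  by move=> h; apply/(tail_set_scale _ _ _ _ _ hC (a0 _ t0)); rewrite mulr1 mulr0.
apply/negP; rewrite -ltNge.
apply: (@lt_le_trans _ _ (t%:E * P [set w | tail_set C r 0 (Z w)])%E); last first.
  apply: lee_wpmul2l; first by rewrite lee_fin ltW.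
  apply: le_measure; rewrite ?inE// => w [Ow rw nw]; split => //.
  exact: le_trans (ltW atr) rw.
rewrite -[P _]fineK ?fin_num_measure// -EFinM lte_fin -ltr_pdivrMr; last first.
  by rewrite fine_gt0// Pr/= ltey_eq fin_num_measure.
by near: t; apply: nbhs_pinfty_gt; exact: num_real.
Unshelve. all: by end_near. Qed.

Definition norm_tail {R : realType} {L : nat} {d : measure_display}
    {T : measurableType d} (P : probability T R) (Z : T -> 'rV[R]_L) (y : R) : R :=
  fine (P [set w | y <= `|Z w|]).

Lemma norm_measurable {R : realType} {L : nat} {d : measure_display}
    {T : measurableType d} (Z : T -> 'rV[R]_L) :
  measurable_fun setT (Z : T -> borel_rV R L) ->
  measurable_fun setT (fun w => `|Z w|).
Proof.
move=> mZ; apply: (measurableT_comp (f := (fun x : 'rV[R]_L => `|x|) : borel_rV R L -> R)) => //.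
by apply: continuous_borel; exact: norm_continuous.
Qed.

Lemma MRV_norm_tail_le_powR {R : realType} {L : nat} (p : R) {d : measure_display}
    {T : measurableType d} (P : probability T R) (Z : T -> 'rV[R]_L)
    (gamma : R) (a : R -> R) (mu : {measure set (borel_rV R L) -> \bar R})
    (beta : R) :
  (0 < L)%N -> 1 <= p -> (forall w, orthant R L (Z w)) ->
  measurable_fun setT (Z : T -> borel_rV R L) ->
  MRV p P Z gamma a mu [set 0] -> 0 < beta -> beta < gamma ->
  exists2 k, 0 <= k & \forall y \near +oo, norm_tail P Z y <= k * y `^ (- beta).
Proof.
move=> L0 p1 OZ mZ [gamma0 rv hmu _ hcvg] beta0 bg.
have [C0 _ cC _] := @closed_cone_set0 R L; have [a0 _] := rv.
have [K hK] := scaled_tail_bounded p P Z a [set 0] mu 1 L0 p1 C0 cC ltr01 mZ hmu hcvg.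
have mlev y : measurable [set w | y <= `|Z w|].
  by apply: (level_measurable _ _ _).2; exact: norm_measurable.
apply: (tail_le_powR a _ gamma^-1 beta K rv) => //.
- by rewrite mulrC ltr_pdivrMr// mul1r.
- move=> x y xy; apply: fine_le; rewrite ?fin_num_measure//.
  by apply: le_measure; rewrite ?inE// => w /=; exact: le_trans.
- by move=> y; exact: fine_ge0.
- near=> t.
  have t0 : 0 < t by near: t; exact: nbhs_pinfty_gt.
  rewrite -lee_fin EFinM fineK ?fin_num_measure//.
  have : (t%:E * P [set w | tail_set [set 0%R] 1 0 ((a t)^-1 *: Z w)] <= K%:E)%E by near: t.
  congr (_ * P _ <= _)%E; apply/seteqP; split => w /=.
    move/(tail_set_scale _ _ _ _ _ closed_cone_set0 (a0 _ t0)); rewrite mulr1 => -[_ + _].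
    by rewrite dist_to0.
  move=> h; apply/(tail_set_scale _ _ _ _ _ closed_cone_set0 (a0 _ t0)).
  by rewrite mulr1 mulr0; split => //; rewrite dist_to0.
Unshelve. all: by end_near. Qed.

(** The cut level is [b0 t ^ s] with [s = 2 m] for some [m < 1] close enough to
    [1]. The exponents [eta = m / alpha0], [beta = m alpha] then satisfy
    [eta s beta = 2 m ^ 3 alpha / alpha0 > 1]. *)
Lemma poisson_bad_negligible {R : realType} {L : nat} (p : R) {d : measure_display}
    {T : measurableType d} (P : probability T R) (c : 'I_L -> R)
    (X Y Z : T -> 'rV[R]_L) (alpha alpha0 : R) (b b0 : R -> R)
    (nu nu0 : {measure set (borel_rV R L) -> \bar R}) (C : set 'rV[R]_L) :
  (0 < L)%N -> 1 <= p -> closed_cone C -> alpha0 < 2 * alpha ->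
  cond_indep_poisson P c X Y ->
  measurable_fun setT (X : T -> borel_rV R L) ->
  measurable_fun setT (Y : T -> borel_rV R L) ->
  measurable_fun setT (Z : T -> borel_rV R L) ->
  (forall w, orthant R L (Z w)) -> (forall w l, Z w 0 l = c l * X w 0 l) ->
  MRV p P Z alpha b nu [set 0] -> MRV p P Z alpha0 b0 nu0 C ->
  exists s : R, forall delta eps : R, 0 < delta -> 0 < eps ->
    \forall t \near +oo,
      (t%:E * P [set w | exists l, poisson_bad c X Y (b0 t `^ s) (delta * b0 t) l w]
       <= eps%:E)%E.
Proof.
move=> L0 p1 hC alpha02 hY mX mY mZ OZ ZX hb hb0.
have [alpha_gt0 _ _ _ _] := hb; have [alpha0_gt0 rv0 _ _ _] := hb0.
have b0_gt0 := rv0.1.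
(* With [e] the subtracted term, [alpha0 / (2 alpha) = 1 - 6 e], while
   [m ^ 3 >= 1 - 3 e]. *)
pose m := 1 - (1 - alpha0 / (2 * alpha)) / 6.
have r0 : 0 < alpha0 / (2 * alpha) by rewrite divr_gt0// mulr_gt0.
have r1 : alpha0 / (2 * alpha) < 1 by rewrite ltr_pdivrMr ?mulr_gt0// mul1r.
have m1 : m < 1 by rewrite /m; lra.
have m0 : 0 < m by rewrite /m; lra.
have m3 : alpha0 / (2 * alpha) < m * m * m.
  have e0 : 0 < 1 - m by rewrite subr_gt0.
  have -> : alpha0 / (2 * alpha) = 1 - 6 * (1 - m) by rewrite /m; lra.
  rewrite -subr_gt0 (_ : _ - _ = (1 - m) * (3 + (1 - m) * (2 + m))); last by ring.
  by rewrite mulr_gt0// addr_gt0// mulr_gt0// addr_gt0.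
have key : 1 < m / alpha0 * (2 * m) * (m * alpha).
  rewrite (_ : m / alpha0 * (2 * m) * (m * alpha) = m * m * m / (alpha0 / (2 * alpha))).
    by rewrite ltr_pdivlMr// mul1r.
  by field; rewrite !lt0r_neq0.
have [k k0 hk] : exists2 k, 0 < k & \forall t \near +oo, k * t `^ (m / alpha0) <= b0 t.
  apply: (MRV_scaling_ge_powR p P Z alpha0 b0 nu0 C) => //.
    by rewrite divr_ge0 ?ltW.
  by rewrite ltr_pdivrMr// mulVf ?lt0r_neq0.
have [k' k'0 hk'] : exists2 k', 0 <= k' &
    \forall y \near +oo, norm_tail P Z y <= k' * y `^ (- (m * alpha)).
  apply: (MRV_norm_tail_le_powR p P Z alpha b nu) => //; first exact: mulr_gt0.
  by rewrite gtr_pMl.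
have mlev y : measurable [set w | y <= `|Z w|].
  by apply: (level_measurable _ _ _).2; exact: norm_measurable.
have Gmono x y : x <= y -> norm_tail P Z y <= norm_tail P Z x.
  move=> xy; apply: fine_le; rewrite ?fin_num_measure//.
  by apply: le_measure; rewrite ?inE// => w /=; exact: le_trans.
exists (2 * m) => delta eps delta0 eps0.
have L0R : 0 < L%:R :> R by rewrite ltr0n.
have e20 : 0 < eps / L%:R / 2 by rewrite !divr_gt0.
have hG := scaled_tail_powR_small b0 (norm_tail P Z) k (m / alpha0) (2 * m) (m * alpha)
  k' _ k0 (divr_gt0 m0 alpha0_gt0) (mulr_gt0 (ltr0n _ 2) m0) (mulr_gt0 m0 alpha_gt0)
  key e20 hk hk' Gmono.
have hE := scaled_expR_powR_small b0 k (m / alpha0) (1 - m) (2 * expR 2) delta _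
  k0 (divr_gt0 m0 alpha0_gt0) _ (mulr_gt0 (ltr0n _ 2) (expR_gt0 _)) delta0 e20 hk.
near=> t.
have t0 : 0 < t by near: t; exact: nbhs_pinfty_gt.
have bt0 := b0_gt0 _ t0.
(* The Chernoff parameter is the inverse square root of the cut level. *)
pose x := b0 t `^ (- m).
have x0 : 0 <= x by exact: powR_ge0.
have bne : b0 t != 0 by rewrite lt0r_neq0.
have powD y z : b0 t `^ (y + z) = b0 t `^ y * b0 t `^ z.
  by rewrite powRD// bne implybT.
have x1 : x <= 1 / 2.
  have kt : 2 `^ m^-1 <= b0 t.
    apply: (@le_trans _ _ (k * t `^ (m / alpha0))); last by near: t.
    by apply: ltW; near: t; apply: powR_pinfty => //; exact: divr_gt0.
  rewrite /x powRN mul1r lef_pV2 ?posrE ?powR_gt0//.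
  rewrite (_ : 2 = (2 `^ m^-1) `^ m); last by rewrite -powRrM mulVf ?lt0r_neq0// powRr1.
  by apply: ge0_ler_powR; rewrite ?nnegrE ?powR_ge0 ?(ltW m0) ?(ltW bt0).
have xu : 2 * b0 t `^ (2 * m) * x ^+ 2 - x * (delta * b0 t) = 2 - delta * b0 t `^ (1 - m).
  rewrite /x expr2 -mulrA -!powD (_ : 2 * m + (- m + - m) = 0); last by ring.
  by rewrite powRr0 powD powRr1 ?(ltW bt0)//; ring.
have each l : measurable (poisson_bad c X Y (b0 t `^ (2 * m)) (delta * b0 t) l) /\
    (P (poisson_bad c X Y (b0 t `^ (2 * m)) (delta * b0 t) l) <=
    (norm_tail P Z (b0 t `^ (2 * m)) + 2 * expR 2 * expR (- (delta * b0 t `^ (1 - m))))%:E)%E.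
  have cX0 w : 0 <= c l * X w 0 l by rewrite -ZX; exact: OZ.
  have x01 : 0 <= x <= 1 / 2 by rewrite x0.
  split; first exact: poisson_bad_measurable.
  apply: (le_trans (poisson_bad_le P c X Y _ _ x l hY mX mY cX0 x01)); rewrite EFinD; apply: leeD.
    rewrite fineK ?fin_num_measure//; apply: le_measure; rewrite ?inE//.
      apply: (level_measurable _ _ _).2; apply: measurable_funM => //.
      exact: (measurableT_comp (coord_borel l) mX).
    by move=> w /= /le_trans; apply; rewrite -ZX (le_trans (ler_norm _))// ler_coord_norm.
  by rewrite xu expRD mulrA.
have [mex Pex] := measure_exists_le P _ _ (fun l => (each l).1).
apply: le_trans (lee_wpmul2l _ Pex) _; first by rewrite lee_fin ltW.
apply: le_trans (lee_wpmul2l _ (lee_sum _ (fun l _ => (each l).2))) _; first by rewrite lee_fin ltW.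
rewrite sumEFin -EFinM lee_fin sumr_const card_ord -[X in t * X]mulr_natr mulrA.
rewrite -ler_pdivlMr// mulrDr [leRHS]splitr; apply: lerD.
  by near: t.
by near: t; apply: hE; rewrite subr_gt0.
Unshelve. all: by end_near. Qed.

(** * Transfer of the limit measure *)

Lemma Mtest_support {R : realType} {L : nat} (p : R) (C : set 'rV[R]_L)
    (f : 'rV[R]_L -> R) :
  (0 < L)%N -> 1 <= p -> C !=set0 -> Mtest p C f ->
  exists2 r : R, 0 < r &
    forall x, (f \_ (orthant R L `\` C)) x != 0 -> r <= dist_to C x.
Proof.
move=> L0 p1 C0 [_ _ _ /(bounded_awayP _ _ _ L0 p1 C0)[r r0 hr]].
exists r => // x; rewrite patchE; case: ifPn => [/set_mem Ex fx|]; last by rewrite eqxx.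
by apply: hr; split => //; apply: subset_closure.
Qed.

Lemma Mtest_bound {R : realType} {L : nat} (p : R) (C : set 'rV[R]_L)
    (f : 'rV[R]_L -> R) : Mtest p C f ->
  exists2 K : R, 0 < K & forall x, 0 <= (f \_ (orthant R L `\` C)) x <= K.
Proof.
move=> [_ f0 [K fK] _]; exists (`|K| + 1); first by rewrite ltr_wpDl.
move=> x; rewrite patchE; case: ifPn => [/set_mem Ex|_].
  rewrite f0//= (le_trans (fK _ Ex))// (le_trans (ler_norm _))//.
  by rewrite lerDl.
by rewrite lexx addr_ge0.
Qed.

(** Extended by [0], a test function is continuous on the whole orthant: near
    a point of [C] it vanishes identically, since its support stays away from
    [C]. *)
Lemma Mtest_continuous {R : realType} {L : nat} (p : R) (C : set 'rV[R]_L)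
    (f : 'rV[R]_L -> R) (x : 'rV[R]_L) (e : R) :
  (0 < L)%N -> 1 <= p -> C !=set0 -> closed C -> Mtest p C f ->
  orthant R L x -> 0 < e ->
  \forall y \near x, orthant R L y ->
    `|(f \_ (orthant R L `\` C)) x - (f \_ (orthant R L `\` C)) y| < e.
Proof.
move=> L0 p1 C0 cC hf Ox e0.
have [r r0 hr] := Mtest_support p C f L0 p1 C0 hf.
have [Cx|nCx] := pselect (C x).
  have zero z : dist_to C z < r -> (f \_ (orthant R L `\` C)) z = 0.
    by move=> zr; apply: contrapT => /eqP /hr; rewrite leNgt zr.
  near=> y => _; rewrite !zero ?subrr ?normr0//; last by rewrite dist_to_eq0.
  near: y; apply: (cvgr_lt (dist_to C x)); last by rewrite dist_to_eq0.
  exact: dist_to_continuous.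
case: hf => [cf _ _ _].
have Ex : (orthant R L `\` C) x by [].
have /subspace_continuousP/(_ x Ex)/cvgrPdist_lt/(_ e e0) := cf.
rewrite near_withinE => hnear.
near=> y => Oy.
have nCy : ~ C y.
  by near: y; apply: open_nbhs_nbhs; split => //; exact: closed_openC.
have fxy : (orthant R L `\` C) y -> `|f x - f y| < e by near: y.
by rewrite !patchE !mem_set//; exact: fxy.
Unshelve. all: by end_near. Qed.

Lemma expectation_close {R : realType} {d : measure_display} {T : measurableType d}
    (P : probability T R) (f g : T -> R) (A B D : set T) (K e : R) :
  measurable_fun setT f -> measurable_fun setT g ->
  measurable A -> measurable B -> measurable D -> 0 <= K -> 0 <= e ->
  (forall w, 0 <= f w) -> (forall w, 0 <= g w) ->
  (forall w, f w <= g w + (K * \1_D w + e * \1_A w + K * \1_B w)) ->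
  (\int[P]_w (f w)%:E <=
   \int[P]_w (g w)%:E + (K%:E * P D + e%:E * P A + K%:E * P B))%E.
Proof.
move=> mf mg mA mB mD K0 e0 f0 g0 fg.
have term (k : R) (S : set T) : 0 <= k -> measurable S ->
    (\int[P]_w (k * \1_S w)%:E = k%:E * P S)%E.
  move=> k0 mS; under eq_integral do rewrite EFinM.
  rewrite ge0_integralZl_EFin//; last first.
        by apply/measurable_EFinP; exact: measurable_indic.
  by rewrite integral_indic// setIT.
have mI (k : R) (S : set T) : measurable S ->
    measurable_fun setT (fun w => (k * \1_S w)%:E).
  move=> mS; apply/measurable_EFinP; apply: measurable_funM.
    exact: measurable_cst.
  exact: measurable_indic.
have I0 (k : R) (S : set T) w : 0 <= k -> (0 <= (k * \1_S w)%:E)%E.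
  by move=> k0; rewrite lee_fin mulr_ge0.
have mgE : measurable_fun setT (fun w => (g w)%:E) by apply/measurable_EFinP.
have mh : measurable_fun setT
   (fun w => (K * \1_D w)%:E + (e * \1_A w)%:E + (K * \1_B w)%:E)%E.
  by apply: emeasurable_funD; [apply: emeasurable_funD|]; exact: mI.
have sumI : (\int[P]_w ((K * \1_D w)%:E + (e * \1_A w)%:E + (K * \1_B w)%:E) =
    K%:E * P D + e%:E * P A + K%:E * P B)%E.
  rewrite ge0_integralD//.
  - rewrite ge0_integralD//; [by rewrite !term|by move=> w _; exact: I0|exact: mI
      |by move=> w _; exact: I0|exact: mI].
  - by move=> w _; apply: adde_ge0; exact: I0.
  - by apply: emeasurable_funD; exact: mI.
  - by move=> w _; exact: I0.
  - exact: mI.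
rewrite -sumI -ge0_integralD//; last 2 first.
- by move=> w _; rewrite lee_fin.
- by move=> w _; rewrite !adde_ge0 ?I0.
apply: ge0_le_integral => //.
- by move=> w _; rewrite lee_fin.
- exact/measurable_EFinP.
- by apply: emeasurable_funD.
- by move=> w _; rewrite -!EFinD lee_fin.
Qed.

Lemma bounded_orthant_compact {R : realType} {L : nat} (M : R) :
  compact [set x : 'rV[R]_L | orthant R L x /\ `|x| <= M].
Proof.
apply: bounded_closed_compact.
  exists M; split; first exact: num_real.
  by move=> N MN x [_ xM]; exact: le_trans xM (ltW MN).
apply: closedI; first exact: orthant_closed.
apply: (@preimage_closed _ _ (fun x : 'rV[R]_L => `|x|) [set z | z <= M]).
  by move=> x _; exact: norm_continuous.
exact: closed_le.
Qed.

Lemma poisson_good_close {R : realType} {L : nat} {T : Type} (c : 'I_L -> R)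
    (X Y Z : T -> 'rV[R]_L) (u delta k : R) (w : T) :
  (forall l, Z w 0 l = c l * X w 0 l) -> 0 < k -> 0 <= delta ->
  ~ (exists l, poisson_bad c X Y u (delta * k) l w) ->
  orthant R L (k^-1 *: Y w) /\ `|k^-1 *: Z w - k^-1 *: Y w| <= delta.
Proof.
move=> ZX k0 delta0 good; split=> [l|].
  rewrite mxE; apply: mulr_ge0; first by rewrite invr_ge0 ltW.
  have [[n ->]|nY] := pselect (exists n : nat, Y w 0 l = n%:R); first exact: ler0n.
  by case: good; exists l; exact: Or31.
rewrite -scalerBr normrZ gtr0_norm ?invr_gt0// ler_pdivrMl// mulrC.
apply: ler_norm_coord; first by rewrite mulr_ge0// ltW.
move=> l; rewrite !mxE ZX distrC leNgt; apply/negP => h.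
by apply: good; exists l; apply: Or33; exact: ltW.
Qed.

(** The core of the proof: convergence passes from [Z] to the Poisson vector
    [Y] with intensities [Z]. The pair [(b, nu)] enters through the size
    of [Z] at probability level [1/t], which bounds the deviations [Y - Z]. *)
Lemma poisson_Mcvg {R : realType} {L : nat} (p : R) {d : measure_display}
    {T : measurableType d} (P : probability T R) (c : 'I_L -> R)
    (X Y Z : T -> 'rV[R]_L) (alpha alpha0 : R) (b b0 : R -> R)
    (nu nu0 : {measure set (borel_rV R L) -> \bar R}) (C : set 'rV[R]_L) :
  (0 < L)%N -> 1 <= p -> closed_cone C -> alpha0 < 2 * alpha ->
  cond_indep_poisson P c X Y ->
  measurable_fun setT (X : T -> borel_rV R L) ->
  measurable_fun setT (Y : T -> borel_rV R L) ->
  measurable_fun setT (Z : T -> borel_rV R L) ->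
  (forall w, orthant R L (Z w)) -> (forall w l, Z w 0 l = c l * X w 0 l) ->
  MRV p P Z alpha b nu [set 0] -> MRV p P Z alpha0 b0 nu0 C ->
  Mcvg p C (scaled_law P Y b0) nu0.
Proof.
move=> L0 p1 hC alpha02 hY mX mY mZ OZ ZX hb hb0.
have [C0 _ cC _] := hC.
have [s hbad] := poisson_bad_negligible p P c X Y Z alpha alpha0 b b0 nu nu0 C
  L0 p1 hC alpha02 hY mX mY mZ OZ ZX hb hb0.
have [_ [b0_gt0 _] hnu0 _ hcvg] := hb0.
move=> f hf; have mE := cone_complement_borel _ cC.
have [cf f0 _ _] := hf.
have [r r0 hr] := Mtest_support p C f L0 p1 C0 hf.
have [K K0 hK] := Mtest_bound p C f hf.
set g := f \_ (orthant R L `\` C) in hr hK.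
have mg : measurable_fun setT (g : borel_rV R L -> R) by exact: restrict_borel.
have r20 : 0 < r / 2 by rewrite divr_gt0.
have msc (V : T -> 'rV[R]_L) t : measurable_fun setT (V : T -> borel_rV R L) ->
    measurable_fun setT (fun w => g ((b0 t)^-1 *: V w)).
  by move=> mV; apply: (measurableT_comp mg); exact: scale_measurable.
pose E (V : T -> 'rV[R]_L) t := (t%:E * \int[P]_w (g ((b0 t)^-1 *: V w))%:E)%E.
have EE V t : measurable_fun setT (V : T -> borel_rV R L) -> 0 < t ->
    (\int[scaled_law P V b0 t]_(x in orthant R L `\` C) (f x)%:E)%E = E V t.
  by move=> mV t0; rewrite integral_scaled_law.
have close eps : 0 < eps -> \forall t \near +oo,
    (E Y t <= E Z t + eps%:E)%E /\ (E Z t <= E Y t + eps%:E)%E.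
  move=> eps0.
  have eK0 : 0 < eps / 3 / K by rewrite !divr_gt0.
  have [M M0 hM] := scaled_tail_tight p P Z b0 C nu0 (r / 2) _ L0 p1 C0 cC r20 eK0 mZ hnu0 hcvg.
  have [K1 hK1] := scaled_tail_bounded p P Z b0 C nu0 (r / 2) L0 p1 C0 cC r20 mZ hnu0 hcvg.
  have K10 : 0 < `|K1| + 1 by rewrite ltr_wpDl.
  pose e1 := eps / 3 / (`|K1| + 1).
  have e10 : 0 < e1 by rewrite !divr_gt0.
  have [del0 del00 hdel0] := uniformly_continuous_compact _ _ g e1 e10
    (bounded_orthant_compact M) (fun x h => h.1)
    (fun x Ox e => Mtest_continuous p C f x e L0 p1 C0 cC hf Ox).
  (* The bound by [r / 2] keeps [Z / b0 t] away from [C] as soon as one of the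
     two points lies in the support of [g]. *)
  pose del := Num.min del0 (r / 2).
  have del_gt0 : 0 < del by rewrite lt_min del00.
  have hb1 := hbad del (eps / 3 / K) del_gt0 eK0.
  near=> t.
  have t0 : 0 < t by near: t; exact: nbhs_pinfty_gt.
  have bt0 := b0_gt0 _ t0.
  have hD : (t%:E * P [set w | exists l, poisson_bad c X Y (b0 t `^ s) (del * b0 t) l w]
    <= (eps / 3 / K)%:E)%E by near: t.
  have hA : (t%:E * P [set w | tail_set C (r / 2) 0 ((b0 t)^-1 *: Z w)] <= K1%:E)%E by near: t.
  have hB : (t%:E * P [set w | tail_set C (r / 2) M ((b0 t)^-1 *: Z w)]
    <= (eps / 3 / K)%:E)%E by near: t.
  pose D := [set w | exists l, poisson_bad c X Y (b0 t `^ s) (del * b0 t) l w].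
  pose A := [set w | tail_set C (r / 2) 0 ((b0 t)^-1 *: Z w)].
  pose B := [set w | tail_set C (r / 2) M ((b0 t)^-1 *: Z w)].
  have mts m : measurable [set w | tail_set C (r / 2) m ((b0 t)^-1 *: Z w)].
    rewrite -[X in measurable X]setTI; apply: (scale_measurable _ _ mZ measurableT).
    by apply: closed_borel; exact: tail_set_closed.
  have mD : measurable D.
    by apply: (measure_exists_le P _ _ _).1 => l; exact: poisson_bad_measurable.
  have OZt w : orthant R L ((b0 t)^-1 *: Z w).
    by move=> l; rewrite mxE mulr_ge0 ?OZ// invr_ge0 ltW.
  have bound w : `|g ((b0 t)^-1 *: Z w) - g ((b0 t)^-1 *: Y w)| <=
      K * \1_D w + e1 * \1_A w + K * \1_B w.
    set x := _ *: Z w; set y := _ *: Y w.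
    have i0 (S : set T) (k : R) : 0 < k -> 0 <= k * \1_S w.
      by move=> k0; rewrite mulr_ge0// ltW.
    have gK : `|g x - g y| <= K.
      have /andP[? ?] := hK x; have /andP[? ?] := hK y.
      by rewrite ler_norml; apply/andP; split; lra.
    have [Dw|nDw] := pselect (D w).
      rewrite [X in K * X]indicE mem_set// mulr1 -addrA (le_trans gK)// lerDl.
      by rewrite addr_ge0// i0.
    have [Oy xy] := poisson_good_close c X Y Z _ _ _ w (ZX w) bt0 (ltW del_gt0) nDw.
    (* Too close to [C]: both values of [g] vanish. *)
    have [Aw|nAw] := pselect (A w); last first.
      have xr : dist_to C x < r / 2.
        by rewrite ltNge; apply/negP => h; apply: nAw; split.
      have zero z : dist_to C z < r -> g z = 0.
        by move=> zr; apply: contrapT => /eqP /hr; rewrite leNgt zr.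
      have xr' : dist_to C x < r by rewrite (lt_trans xr)// gtr_pMr ?invf_lt1// ltr1n.
      have yr : dist_to C y < r.
        rewrite (le_lt_trans (dist_to_lip _ _ x C0))// (splitr r) ltr_leD//.
        by apply: (@le_trans _ _ del); [rewrite distrC|rewrite ge_min lexx orbT].
      by rewrite !zero// subrr normr0 !addr_ge0// i0.
    have [Bw|nBw] := pselect (B w).
      rewrite [X in _ + K * X]indicE mem_set// mulr1 (le_trans gK)// lerDr.
      by rewrite addr_ge0// i0.
    have xM : `|x| <= M.
      by rewrite leNgt; apply/negP => /ltW h; apply: nBw; case: Aw.
    rewrite [X in e1 * X]indicE mem_set// mulr1.
    apply: le_trans (_ : e1 <= _); last by rewrite addrAC lerDr addr_ge0// i0.
    apply: hdel0 => //; first exact: (conj (OZt w) xM).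
    by apply: (le_trans xy); rewrite ge_min lexx.
  have budget : (t%:E * (K%:E * P D + e1%:E * P A + K%:E * P B) <= eps%:E)%E.
    have mA := mts 0; have mB := mts M.
    move: hD hA hB.
    rewrite -/D -/A -/B -[P D]fineK ?fin_num_measure// -[P A]fineK ?fin_num_measure//.
    rewrite -[P B]fineK ?fin_num_measure// -!EFinM !lee_fin => hD hA hB.
    rewrite [leLHS](_ : _ = K * (t * fine (P D)) + e1 * (t * fine (P A)) + K * (t * fine (P B))); last by ring.
    rewrite [leRHS](_ : _ = K * (eps / 3 / K) + e1 * (`|K1| + 1) + K * (eps / 3 / K)); last first.
      by rewrite /e1; field; rewrite !lt0r_neq0.
    apply: lerD; last by rewrite ler_pM2l.
    apply: lerD; first by rewrite ler_pM2l.
    by rewrite ler_pM2l// (le_trans hA)// (le_trans (ler_norm _))// lerDl.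
  have g0 V w : 0 <= g ((b0 t)^-1 *: V w) by have /andP[] := hK ((b0 t)^-1 *: V w).
  have final U V : measurable_fun setT (U : T -> borel_rV R L) ->
      measurable_fun setT (V : T -> borel_rV R L) ->
      (forall w, `|g ((b0 t)^-1 *: U w) - g ((b0 t)^-1 *: V w)| <=
        K * \1_D w + e1 * \1_A w + K * \1_B w) ->
      (E U t <= E V t + eps%:E)%E.
    move=> mU mV hUV.
    apply: le_trans (_ : E V t + t%:E * (K%:E * P D + e1%:E * P A + K%:E * P B) <= _)%E.
      rewrite /E -ge0_muleDr; last 2 first.
      - by apply: integral_ge0 => w _; rewrite lee_fin.
      - by rewrite !adde_ge0// mule_ge0// lee_fin ltW.
      apply: lee_wpmul2l; first by rewrite lee_fin ltW.
      apply: expectation_close => //; [exact: msc|exact: msc|exact: mts|exact: mts|exact: ltW|exact: ltW|].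
      by move=> w; rewrite -lerBlDl (le_trans (ler_norm _)).
    by apply: leeD.
  by split; apply: final => // w; rewrite distrC.
have fin : (\int[nu0]_(x in orthant R L `\` C) (f x)%:E)%E \is a fin_num.
  rewrite ge0_fin_numE; last by apply: integral_ge0 => x Ex; rewrite lee_fin f0.
  have mts : measurable (tail_set C r 0 : set (borel_rV R L)).
    by apply: closed_borel; exact: tail_set_closed.
  have tfin := tail_set_finite p C nu0 r 0 L0 p1 C0 r0 hnu0.
  apply: (@le_lt_trans _ _ (\int[nu0]_x (K * \1_(tail_set C r 0) x)%:E)%E).
    rewrite integral_mkcond; apply: ge0_le_integral => //.
    - by move=> x _; rewrite restrict_EFin lee_fin; have /andP[] := hK x.
    - by rewrite restrict_EFin; apply/measurable_EFinP.
    - apply/measurable_EFinP; apply: measurable_funM => //; exact: measurable_indic.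
    - move=> x _; rewrite restrict_EFin lee_fin -/g.
      have [->|gx] := eqVneq (g x) 0; first by rewrite mulr_ge0// ltW.
      rewrite indicE mem_set ?mulr1; first by have /andP[] := hK x.
      split => //; last exact: hr.
      by move: gx; rewrite /g patchE; case: ifPn => [/set_mem[]|]; rewrite ?eqxx.
  under eq_integral do rewrite EFinM.
  rewrite ge0_integralZl_EFin//; [|by apply/measurable_EFinP; exact: measurable_indic|exact: ltW].
  by rewrite integral_indic// setIT lte_mul_pinfty// lee_fin ltW.
rewrite -(fineK fin); set I := fine _.
have limZ : E Z t @[t --> +oo] --> I%:E.
  rewrite /I (fineK fin); apply: cvg_trans (hcvg f hf); apply: near_eq_cvg.
  by near=> t; rewrite EE//; near: t; exact: nbhs_pinfty_gt.
have nearI eps : 0 < eps -> \forall t \near +oo,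
    ((I - eps)%:E < E Z t)%E /\ (E Z t < (I + eps)%:E)%E.
  move=> eps0; near=> t; split; near: t.
    apply: (limZ [set y | ((I - eps)%:E < y)%E]); apply: open_nbhs_nbhs.
    by split; [exact: open_ereal_gt_ereal|rewrite /= lte_fin ltrBlDr ltrDl].
  apply: (limZ [set y | (y < (I + eps)%:E)%E]); apply: open_nbhs_nbhs.
  by split; [exact: open_ereal_lt_ereal|rewrite /= lte_fin ltrDl].
have nearY eps : 0 < eps -> \forall t \near +oo,
    ((I - eps)%:E <= E Y t)%E /\ (E Y t <= (I + eps)%:E)%E.
  move=> eps0; have e20 : 0 < eps / 2 by rewrite divr_gt0.
  near=> t.
  have [YZ ZY] : (E Y t <= E Z t + (eps / 2)%:E)%E /\ (E Z t <= E Y t + (eps / 2)%:E)%E.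
    by near: t; exact: close.
  have [IZ ZI] : ((I - eps / 2)%:E < E Z t)%E /\ (E Z t < (I + eps / 2)%:E)%E.
    by near: t; exact: nearI.
  split.
    rewrite (_ : I - eps = I - eps / 2 - eps / 2); last by rewrite -addrA -opprD -splitr.
    by rewrite EFinB leeBlDr// (le_trans (ltW IZ)).
  rewrite (splitr eps) addrA EFinD (le_trans YZ)//.
  by apply: leeD => //; exact: ltW.
suff h : E Y t @[t --> +oo] --> I%:E.
  apply: cvg_trans h; apply: near_eq_cvg.
  by near=> t; rewrite EE//; near: t; exact: nbhs_pinfty_gt.
apply/fine_cvgP; split.
  have := nearY 1 ltr01; apply: filterS => t [lo hi].
  by rewrite fin_numElt (lt_le_trans (ltNyr _) lo) (le_lt_trans hi (ltry _)).
apply/cvgrPdist_le => eps eps0; have := nearY eps eps0; apply: filterS => t [lo hi].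
have fY : E Y t \is a fin_num.
  by rewrite fin_numElt (lt_le_trans (ltNyr _) lo) (le_lt_trans hi (ltry _)).
rewrite -(fineK fY) !lee_fin in lo hi.
by rewrite /= ler_norml; apply/andP; split; lra.
Unshelve. all: by end_near. Qed.

Lemma lipschitz_continuous {R : realType} {V W : normedModType R} (k : R) (f : V -> W) :
  (forall x y, `|f x - f y| <= k * `|x - y|) -> continuous f.
Proof.
move=> hf x; apply/cvgrPdist_le => e e0; near=> y.
apply: (le_trans (hf x y)); apply: le_trans (_ : (`|k| + 1) * `|x - y| <= _).
  by rewrite ler_wpM2r// (le_trans (ler_norm _))// lerDl.
have k0 : 0 < `|k| + 1 by rewrite ltr_wpDl.
rewrite -ler_pdivlMl// mulrC; near: y.
by apply: cvgr_dist_le => //; exact: divr_gt0.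
Unshelve. all: by end_near. Qed.

Lemma coordwise_scaling_continuous {R : realType} {L : nat} (c : 'I_L -> R) :
  continuous (fun x : 'rV[R]_L => \row_l (c l * x 0 l)).
Proof.
apply: (@lipschitz_continuous R 'rV[R]_L 'rV[R]_L (\sum_l `|c l|)) => x y.
have c0 : 0 <= \sum_l `|c l| by exact: sumr_ge0.
apply: ler_norm_coord => [|l]; first exact: mulr_ge0.
have := ler_coord_norm (x - y) l; rewrite !mxE -mulrBr normrM => xy.
apply: ler_pM => //; rewrite (bigD1 l)//= lerDl.
exact: sumr_ge0.
Qed.

Theorem theorem2p4 (R : realType) (L : nat) (hL : (1 <= L)%N)
    (p : R) (hp : 1 <= p)
    (alpha alpha0 : R) (halpha : 0 < alpha)
    (halpha0 : alpha <= alpha0 < 2 * alpha)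
    (d : measure_display) (T : measurableType d) (P : probability T R)
    (W D : {RV P >-> borel_rV R L})
    (c : 'I_L -> R) (hc : forall l, 0 < c l)
    (hW0 : forall w, orthant R L (W w))
    (hWc : continuous_distribution P W)
    (hD : cond_indep_poisson P c W D) :
  let cW : T -> 'rV[R]_L := fun w => \row_l (c l * (W w : 'rV[R]_L) 0 l) in
  (forall (b : R -> R) (nu : {measure set (borel_rV R L) -> \bar R}),
      MRV p P cW alpha b nu [set 0] ->
      MRV p P D alpha b nu [set 0])
  /\
  (forall (b b0 : R -> R) (nu nu0 : {measure set (borel_rV R L) -> \bar R})
      (C0 : set 'rV[R]_L),
      closed_cone C0 ->
      b t / b0 t @[t --> +oo] --> +oo ->
      MRV p P cW alpha b nu [set 0] ->
      MRV p P cW alpha0 b0 nu0 C0 ->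
      MRV p P D alpha b nu [set 0] /\ MRV p P D alpha0 b0 nu0 C0).

Proof.
move=> cW.
have mW : measurable_fun setT (W : T -> borel_rV R L) by exact: measurable_funPT.
have mD : measurable_fun setT (D : T -> borel_rV R L) by exact: measurable_funPT.
have mcW : measurable_fun setT (cW : T -> borel_rV R L).
  exact: (measurableT_comp (continuous_borel_rV _ (coordwise_scaling_continuous c)) mW).
have cWE w l : cW w 0 l = c l * (W w : 'rV[R]_L) 0 l by rewrite mxE.
have OcW w : orthant R L (cW w).
  by move=> l; rewrite cWE mulr_ge0 ?hW0// ltW.
have transfer b a0 a (nu mu : {measure set (borel_rV R L) -> \bar R}) C :
    closed_cone C -> a0 < 2 * alpha ->
    MRV p P cW alpha b nu [set 0] -> MRV p P cW a0 a mu C -> MRV p P D a0 a mu C.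
  move=> hC ha hb ha0.
  have cvgD := poisson_Mcvg p P c W D cW alpha a0 b a nu mu C hL hp hC ha hD
    mW mD mcW OcW cWE hb ha0.
  by case: ha0 => ? ? ? ? _; split.
have two : alpha < 2 * alpha by rewrite ltr_pMl// ltr1n.
split=> [b nu hb|b b0 nu nu0 C0 hC _ hb hb0].
  exact: (transfer b alpha b nu nu _ closed_cone_set0 two hb hb).
have /andP[_ ha0] := halpha0.
split; first exact: (transfer b alpha b nu nu _ closed_cone_set0 two hb hb).
exact: (transfer b alpha0 b0 nu nu0 C0 hC ha0 hb hb0).
Qed.
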